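(* Let $n\ge 1$ be an integer and let $F:L^n\to\mathbb{R}$ be such that there exists a continuous function $f:\mathbb{R}^n\to\mathbb{R}$ with $F(X)=f(\mathbb{E}[X],\mathbb{E}[X^2],\dots,\mathbb{E}[X^n])$ for all $X\in L^n$. Suppose that $F$ is additive, i.e., $F(X+Y)=F(X)+F(Y)$ for all independent $X,Y\in L^n$. Then $F$ is a linear combination of cumulants of order at most $n$: there exist $c_1,\dots,c_n\in\mathbb{R}$ such that $F(X)=\sum_{\ell=1}^n c_\ell\,\kappa_\ell(X)$ for all $X\in L^n$. Equivalently, $f(x_1,\dots,x_n)=\sum_{\ell=1}^n c_\ell\,\overline{B}_\ell(x_1,\dots,x_\ell)$ for all $(x_1,\dots,x_n)\in\Omega_n$.
   Context: $L^n$ denotes the space of real-valued random variables $X$ with finite $n$-th moment, $\mathbb{E}[|X|^n]<\infty$; the underlying probability space is taken rich enough (e.g. $[0,1]$ with Lebesgue measure) that for any two probability laws on $\mathbb{R}$ with finite $n$-th absolute moment there are independent random variables in $L^n$ having these laws. $\Omega_n=\{(\mathbb{E}[X],\dots,\mathbb{E}[X^n]) : X\in L^n\}\subset\mathbb{R}^n$ is the set of moment sequences. For $X\in L^n$, the cumulants $\kappa_1(X),\dots,\kappa_n(X)\in\mathbb{R}$ are defined by $$\log\left(\mathbb{E}[e^{zX}]\right)=\sum_{\ell=1}^n\frac{z^\ell}{\ell!}\kappa_\ell(X)+o(z^n)\quad\text{as } z\to 0,\ z\in i\mathbb{R}.$$ The logarithmic Bell polynomials $\overline{B}_\ell(x_1,\dots,x_\ell)$,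 $1\le \ell\le n$, are defined by the identity of formal power series $$\log\left(1+\sum_{\ell=1}^n\frac{x_\ell}{\ell!}z^\ell\right)=\sum_{\ell=1}^n\frac{\overline{B}_\ell(x_1,\dots,x_\ell)}{\ell!}z^\ell+O(z^{n+1}).$$ For $X\in L^n$ and $1\le \ell\le n$ one has $\kappa_\ell(X)=\overline{B}_\ell(\mathbb{E}[X],\dots,\mathbb{E}[X^\ell])$. *)

(* Defs.v *)
From HB Require Import structures.
From mathcomp Require Import all_boot all_order all_algebra.
From mathcomp Require Import all_classical all_reals all_analysis.
From mathcomp Require Import complex.
Set Implicit Arguments.
Unset Strict Implicit.
Unset Printing Implicit Defensive.
Import Order.TTheory GRing.Theory Num.Theory.
Import numFieldNormedType.Exports.
Local Open Scope classical_set_scope.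
Local Open Scope ring_scope.

Lemma exponent_ge1 (R : realType) (n : nat) :
  (0 < n)%N -> (1 <= (n%:R : R)%:E)%E.
Proof. by move=> n_gt0; rewrite lee_fin ler1n. Qed.

Definition Ln (d : measure_display) (T : measurableType d) (R : realType)
    (P : probability T R) (n : nat) (n_gt0 : (0 < n)%N) :=
  LfunType P (exponent_ge1 R n_gt0).

Definition indep_RV (d : measure_display) (T : measurableType d) (R : realType)
    (P : probability T R) (X Y : T -> R) : Prop :=
  forall A B : set R, measurable A -> measurable B ->
    P (X @^-1` A `&` Y @^-1` B) = (P (X @^-1` A) * P (Y @^-1` B))%E.

Definition has_law (d : measure_display) (T : measurableType d) (R : realType)
    (P : probability T R) (X : T -> R)
    (mu : probability (measurableTypeR R) R) : Prop :=
  forall A : set R, measurable A -> P (X @^-1` A) = mu A.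

Definition finite_abs_moment (R : realType) (n : nat)
    (mu : probability (measurableTypeR R) R) : Prop :=
  (\int[mu]_x (`|x| ^+ n)%:E < +oo)%E.

Definition rich (d : measure_display) (T : measurableType d) (R : realType)
    (P : probability T R) (n : nat) (n_gt0 : (0 < n)%N) : Prop :=
  forall mu nu : probability (measurableTypeR R) R,
    finite_abs_moment n mu -> finite_abs_moment n nu ->
    exists X Y : Ln P n_gt0,
      [/\ indep_RV P X Y, has_law P X mu & has_law P Y nu].

(* Vectors indexed by 1..n in the mathematics are indexed by 'I_n here, so the
   entry i : 'I_n carries order i.+1. *)
Definition moments (d : measure_display) (T : measurableType d) (R : realType)
    (P : probability T R) (n : nat) (X : T -> R) : 'rV[R]_n :=
  \row_(i < n) fine 'E_P[fun w => X w ^+ i.+1].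

Definition moment_set (d : measure_display) (T : measurableType d)
    (R : realType) (P : probability T R) (n : nat) (n_gt0 : (0 < n)%N) :
    set 'rV[R]_n :=
  [set moments P n X | X in [set: Ln P n_gt0]].

Definition cexpectation (d : measure_display) (T : measurableType d)
    (R : realType) (P : probability T R) (Z : T -> R[i]) : R[i] :=
  (fine 'E_P[fun w => complex.Re (Z w)]
    +i* fine 'E_P[fun w => complex.Im (Z w)])%C.

Definition cexp (R : realType) (z : R[i]) : R[i] :=
  (expR (complex.Re z) * cos (complex.Im z)
    +i* (expR (complex.Re z) * sin (complex.Im z)))%C.

(* Principal determination on nonzero z, with argument in ]-pi, pi]. *)
Definition clog (R : realType) (z : R[i]) : R[i] :=
  let r := Normc.normc z in
  let a := acos (complex.Re z / r) in
  (ln r +i* (if 0 <= complex.Im z then a else - a))%C.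

(* The expansion log E[e^(zX)] = sum_l z^l / l! k_l + o(z^n) as z -> 0 along
   the imaginary axis, with z = i t. *)
Definition is_cumulants (d : measure_display) (T : measurableType d)
    (R : realType) (P : probability T R) (n : nat) (X : T -> R)
    (k : 'rV[R]_n) : Prop :=
  let z (t : R) : R[i] := (0 +i* t)%C in
  let remainder (t : R) : R[i] :=
    clog (cexpectation P (fun w => cexp (z t * (X w)%:C%C)))
    - \sum_(l < n) z t ^+ l.+1 / (l.+1)`!%:R * (k ord0 l)%:C%C in
  (Normc.normc (remainder t) / `|t| ^+ n) @[t --> (0 : R)^'] --> (0 : R).

(* When E[|X|^n] is finite exactly one vector satisfies is_cumulants; the
   default 0 is only used outside L^n. *)
Definition cumulants (d : measure_display) (T : measurableType d)
    (R : realType) (P : probability T R) (n : nat) (X : T -> R) : 'rV[R]_n :=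
  xget 0 [set k : 'rV[R]_n | is_cumulants P X k].

(* log (1 + u) modulo 'X^(n.+1), for u without constant term: the terms u ^+ j
   with j > n of the Mercator series only contribute above degree n. *)
Definition flog1p (R : realType) (n : nat) (u : {poly R}) : {poly R} :=
  \sum_(1 <= j < n.+1) ((-1) ^+ j.+1 / j%:R) *: u ^+ j.

(* The entry l : 'I_n is the logarithmic Bell polynomial of order l.+1, viewed
   as a function of x; it only depends on the entries of x of order <= l.+1. *)
Definition logBell (R : realType) (n : nat) (x : 'rV[R]_n) : 'rV[R]_n :=
  let u := \sum_(k < n) (x ord0 k / (k.+1)`!%:R) *: 'X^(k.+1) in
  \row_(l < n) ((l.+1)`!%:R * (flog1p n u)`_l.+1).

(* Main.v *)
Require Import Defs.
From HB Require Import structures.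
From mathcomp Require Import all_boot all_order all_algebra.
From mathcomp Require Import all_classical all_reals all_analysis.
From mathcomp Require Import complex.
From mathcomp Require Import measurable_realfun.
From mathcomp Require Import ring lra.
Set Implicit Arguments.
Unset Strict Implicit.
Unset Printing Implicit Defensive.
Import Order.TTheory GRing.Theory Num.Theory.
Import numFieldNormedType.Exports.
Local Open Scope classical_set_scope.
Local Open Scope ring_scope.

(* A cumulant vector is read off from log E[e^(itX)] by exponentiating: with
   the remainder of the Taylor expansion of E[e^(itX)] controlled by dominated
   convergence, exp (log (1 + u)) = 1 + u modulo degree > n turns the moments
   into the logarithmic Bell polynomials.

   For the linearity, encode moment vectors as truncated exponential generating
   functions, so that sums of independent variables become products. Sums of
   independent variables equal to t with probability 1/N and to 0 otherwise
   converge to the Poisson law, whose generating function is exp (l v_t) with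
   v_t = e^(tz) - 1; continuity and additivity of f make f linear in l there.
   The cumulant vectors (t, ..., t^n), t = 1, ..., n, form a basis of R^n by
   Vandermonde. Writing the cumulant vector of X as a difference a - b of
   nonnegative combinations of them, X plus an independent compound Poisson
   variable with cumulants b has the cumulants a, which determines f at X. *)

(** * Truncated power series *)

(** Two obstacles shape the second half. A negative intensity need not correspond to any random
    variable, so the part b is moved to the other side: [f] is evaluated on an identity (1 +
    [egf x]) * exp B = exp A in which all intensities are nonnegative. Moreover no Poisson variable
    is constructed: only limits of moment vectors occur, with no claim that they lie in the moment
    set. Continuity of [f] on all of R^n gives it a value there and carries additivity over to the
    limits.

    In the first half, the logarithm is never expanded directly. The identities exp (log (1 + u)) =
    1 + u and exp (a + b) = exp a * exp b modulo degree > n come from uniqueness for a linear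
    differential equation, and estimates on [clog] are pulled back from estimates on [cexp]. The
    choice of branch causes no jump because the logarithms compared all tend to 0 with t. *)

Definition eqmodX (R : nzRingType) (m : nat) (p q : {poly R}) : Prop :=
  forall i, (i < m)%N -> p`_i = q`_i.

Lemma eqmodX_sym (R : nzRingType) m (p q : {poly R}) :
  eqmodX m p q -> eqmodX m q p.
Proof. by move=> pq i im; rewrite pq. Qed.

Lemma eqmodX_trans (R : nzRingType) m (q p r : {poly R}) :
  eqmodX m p q -> eqmodX m q r -> eqmodX m p r.
Proof. by move=> pq qr i im; rewrite pq ?qr. Qed.

Lemma eqmodXD (R : nzRingType) m (p q p' q' : {poly R}) :
  eqmodX m p q -> eqmodX m p' q' -> eqmodX m (p + p') (q + q').
Proof. by move=> pq pq' i im; rewrite !coefD pq ?pq'. Qed.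

Lemma eqmodXN (R : nzRingType) m (p q : {poly R}) :
  eqmodX m p q -> eqmodX m (- p) (- q).
Proof. by move=> pq i im; rewrite !coefN pq. Qed.

Lemma eqmodXZ (R : nzRingType) m a (p q : {poly R}) :
  eqmodX m p q -> eqmodX m (a *: p) (a *: q).
Proof. by move=> pq i im; rewrite !coefZ pq. Qed.

Lemma eqmodXM (R : nzRingType) m (p q p' q' : {poly R}) :
  eqmodX m p q -> eqmodX m p' q' -> eqmodX m (p * p') (q * q').
Proof.
move=> pq pq' i im; rewrite !coefM; apply: eq_bigr => j _.
rewrite pq ?pq' //; first by rewrite (leq_ltn_trans _ im) // leq_subr.
by rewrite (leq_ltn_trans _ im) // -ltnS.
Qed.

Lemma eqmodXX (R : nzRingType) m k (p q : {poly R}) :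
  eqmodX m p q -> eqmodX m (p ^+ k) (q ^+ k).
Proof.
by move=> pq; elim: k => [//|k IH]; rewrite !exprS; apply: eqmodXM.
Qed.

Lemma eqmodX_sum (R : nzRingType) m (I : Type) (r : seq I) (P : pred I)
    (F G : I -> {poly R}) :
  (forall i, P i -> eqmodX m (F i) (G i)) ->
  eqmodX m (\sum_(i <- r | P i) F i) (\sum_(i <- r | P i) G i).
Proof.
move=> FG; apply: (big_ind2 (eqmodX m)) => //.
by move=> *; apply: eqmodXD.
Qed.

Lemma eqmodX_exp0 (R : comNzRingType) (m k : nat) (u : {poly R}) :
  u`_0 = 0 -> (m <= k)%N -> eqmodX m (u ^+ k) 0.
Proof.
move=> u0 mk i im.
have -> : u = 'X * drop_poly 1 u.
  rewrite -[in LHS](poly_take_drop 1 u) expr1 mulrC addrC; apply/eqP.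
  rewrite -subr_eq0 addrC addrK; apply/eqP/polyP => -[|j].
    by rewrite coef_take_poly u0 coef0.
  by rewrite coef_take_poly coef0.
by rewrite exprMn coefXnM (leq_trans im mk) coef0.
Qed.

(** Uniqueness for a linear differential equation: 1 + u has constant coefficient 1, so the
    coefficient of 'X^i in the equation determines (i + 1) times the coefficient i + 1 of D from the
    lower ones. It is applied to the difference of two solutions with the same constant coefficient;
    the order lost by differentiating is regained. *)
Lemma eqmodX_ode (R : numFieldType) (n : nat) (u v D : {poly R}) :
  u`_0 = 0 -> D`_0 = 0 -> eqmodX n ((1 + u) * D^`()) (v * D) ->
  eqmodX n.+1 D 0.
Proof.
move=> u0 D0 ode i; rewrite ltnS coef0.
have [k] := ubnP i; elim: k i => // k IH [//|i]; rewrite ltnS => ik iln.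
have Dz j : (j <= i)%N -> D`_j = 0.
  by move=> ji; apply: IH; [exact: leq_ltn_trans ik|exact: leq_trans (ltnW iln)].
have := ode i iln; rewrite coefM [in RHS]coefMr.
rewrite big_ord_recl subn0 coefD coefC eqxx u0 addr0 mul1r coef_deriv.
rewrite [X in _ + X = _]big1 ?addr0; last first.
  move=> j _; rewrite coef_deriv Dz ?mul0rn ?mulr0 //.
  by rewrite lift0 -subSn // subSS leq_subr.
rewrite big1 => [/eqP|j _]; last first.
  by rewrite Dz ?mulr0 // -ltnS.
by rewrite mulrn_eq0 /= => /eqP.
Qed.

(** Counterpart of [flog1p]: for a without constant term, the omitted powers of a only contribute
    above degree n. *)
Definition fexp (R : numFieldType) (n : nat) (a : {poly R}) : {poly R} :=
  \sum_(j < n.+1) (j`!%:R)^-1 *: a ^+ j.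

Lemma coef0_exp (R : comNzRingType) (u : {poly R}) k :
  u`_0 = 0 -> (u ^+ k)`_0 = (k == 0%N)%:R.
Proof.
move=> u0; rewrite -horner_coef0 horner_exp horner_coef0 u0.
by rewrite expr0n.
Qed.

Lemma coef0_fexp (R : numFieldType) n (a : {poly R}) :
  a`_0 = 0 -> (fexp n a)`_0 = 1.
Proof.
move=> a0; rewrite /fexp coef_sum big_ord_recl coefZ coef0_exp //= invr1 mul1r.
rewrite big1 ?addr0 // => j _.
by rewrite coefZ coef0_exp // mulr0.
Qed.

Lemma fexpS (R : numFieldType) n (a : {poly R}) :
  fexp n.+1 a = fexp n a + (n.+1`!%:R)^-1 *: a ^+ n.+1.
Proof. by rewrite /fexp big_ord_recr. Qed.

Lemma deriv_fexpS (R : numFieldType) n (a : {poly R}) :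
  (fexp n.+1 a)^`() = a^`() * fexp n a.
Proof.
elim: n => [|n IH].
  rewrite /fexp !big_ord_recr !big_ord0 /= !add0r expr0 expr1 derivD !derivZ.
  by rewrite derivC scaler0 add0r invr1 !scale1r mulr1.
rewrite fexpS derivD IH [in RHS]fexpS mulrDr; congr (_ + _).
rewrite derivZ deriv_exp /= -scalerAr -[_ * _ *+ _]scaler_nat scalerA.
congr (_ *: _).
by rewrite [n.+2`!]factS natrM invfM mulrAC mulVf ?mul1r ?pnatr_eq0.
Qed.

Lemma deriv_fexp (R : numFieldType) n (a : {poly R}) :
  a`_0 = 0 -> eqmodX n (fexp n a)^`() (a^`() * fexp n a).
Proof.
case: n => [//|n] a0; rewrite deriv_fexpS fexpS; apply: eqmodXM => //.
rewrite -[X in eqmodX _ X _]addr0; apply: eqmodXD => //.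
rewrite -[X in eqmodX _ X _](scaler0 _ (n.+1`!%:R)^-1); apply: eqmodXZ.
exact/eqmodX_sym/eqmodX_exp0.
Qed.

(** Both sides have constant coefficient 1 and solve y' = (a + b)' y modulo 'X^n. *)
Lemma fexpD (R : numFieldType) n (a b : {poly R}) :
  a`_0 = 0 -> b`_0 = 0 -> eqmodX n.+1 (fexp n (a + b)) (fexp n a * fexp n b).
Proof.
move=> a0 b0; have ab0 : (a + b)`_0 = 0 by rewrite coefD a0 b0 addr0.
suff H : eqmodX n.+1 (fexp n (a + b) - fexp n a * fexp n b) 0.
  by move=> i /H /eqP; rewrite coefB coef0 subr_eq0 => /eqP.
apply: (@eqmodX_ode _ _ 0 (a + b)^`()); rewrite ?coef0 //.
  by rewrite coefB -!horner_coef0 hornerM !horner_coef0 !coef0_fexp // mulr1 subrr.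
rewrite addr0 mul1r derivB derivM mulrBr; apply: eqmodXD.
  exact: deriv_fexp.
apply: eqmodXN; rewrite derivD mulrDl; apply: eqmodXD.
  by rewrite mulrA; apply: eqmodXM => //; apply: deriv_fexp.
by rewrite mulrCA; apply: eqmodXM => //; apply: deriv_fexp.
Qed.

Lemma flog1pS (R : realType) n (u : {poly R}) :
  flog1p n.+1 u = flog1p n u + ((-1) ^+ n.+2 / n.+1%:R) *: u ^+ n.+1.
Proof. by rewrite /flog1p big_nat_recr. Qed.

Lemma coef0_flog1p (R : realType) n (u : {poly R}) :
  u`_0 = 0 -> (flog1p n u)`_0 = 0.
Proof.
move=> u0; elim: n => [|n IH]; first by rewrite /flog1p big_geq // coef0.
by rewrite flog1pS coefD IH coefZ coef0_exp // mulr0 addr0.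
Qed.

(** A telescoping geometric sum. The identity is exact, and its error term (- u) ^+ n has no
    coefficient below degree n once u has no constant term. *)
Lemma deriv_flog1p (R : realType) n (u : {poly R}) :
  (1 + u) * (flog1p n u)^`() = u^`() * (1 - (- u) ^+ n).
Proof.
elim: n => [|n IH].
  by rewrite /flog1p big_geq // derivC expr0 subrr !mulr0.
rewrite flog1pS derivD mulrDr IH derivZ deriv_exp -[_ * _ *+ _]scaler_nat scalerA.
rewrite divfK ?pnatr_eq0 // exprS mulN1r exprS mulN1r opprK /=.
rewrite [in RHS]exprS [(- u) ^+ n]exprNn.
rewrite -mulr_algl -in_algE rmorphXn rmorphN rmorph1 /=.
ring.
Qed.

(** Both sides have constant coefficient 1 and solve (1 + u) y' = u' y modulo 'X^n. *)
Lemma fexp_flog1p (R : realType) n (u : {poly R}) :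
  u`_0 = 0 -> eqmodX n.+1 (fexp n (flog1p n u)) (1 + u).
Proof.
move=> u0; have L0 := coef0_flog1p n u0.
suff H : eqmodX n.+1 (fexp n (flog1p n u) - (1 + u)) 0.
  by move=> i /H /eqP; rewrite coefB coef0 subr_eq0 => /eqP.
apply: (@eqmodX_ode _ _ u u^`()) => //.
  by rewrite coefB coefD u0 coef0_fexp // coefC eqxx addr0 subrr.
rewrite derivB derivD derivC add0r !mulrBr; apply: eqmodXD; last first.
  by rewrite mulrC.
apply: (@eqmodX_trans _ _ ((1 + u) * ((flog1p n u)^`() * fexp n (flog1p n u)))).
  by apply: eqmodXM => //; apply: deriv_fexp.
rewrite mulrA deriv_flog1p; apply: eqmodXM => //.
rewrite -[X in eqmodX _ _ X]mulr1; apply: eqmodXM => //.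
rewrite -[X in eqmodX _ _ X]subr0; apply: eqmodXD => //; apply: eqmodXN.
by apply: eqmodX_exp0; rewrite ?coefN ?u0 ?oppr0.
Qed.

Lemma fexp_eqmodX (R : numFieldType) n m (a b : {poly R}) :
  eqmodX m a b -> eqmodX m (fexp n a) (fexp n b).
Proof.
by move=> ab; apply: eqmodX_sum => j _; apply/eqmodXZ/eqmodXX.
Qed.

(** * The complex exponential and logarithm *)

Lemma normr_Re_le (R : realType) (z : R[i]) : `|complex.Re z| <= Normc.normc z.
Proof.
by case: z => a b /=; rewrite -sqrtr_sqr ler_wsqrtr // lerDl sqr_ge0.
Qed.

Lemma normr_Im_le (R : realType) (z : R[i]) : `|complex.Im z| <= Normc.normc z.
Proof.
by case: z => a b /=; rewrite -sqrtr_sqr ler_wsqrtr // lerDr sqr_ge0.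
Qed.

Lemma normc_ge0 (R : realType) (z : R[i]) : 0 <= Normc.normc z.
Proof. by case: z => a b /=; rewrite sqrtr_ge0. Qed.

Lemma normc_le_ReIm (R : realType) (z : R[i]) :
  Normc.normc z <= `|complex.Re z| + `|complex.Im z|.
Proof.
case: z => a b /=; rewrite -[leRHS]ger0_norm ?addr_ge0 // -sqrtr_sqr.
apply: ler_wsqrtr; rewrite sqrrD !real_normK ?num_real //.
by rewrite -addrA lerD2l lerDr mulrn_wge0 // mulr_ge0.
Qed.

Lemma normc_triangle (R : realType) (x y : R[i]) :
  Normc.normc (x + y) <= Normc.normc x + Normc.normc y.
Proof. exact: le_normcD. Qed.

Lemma normc_opp (R : realType) (x : R[i]) : Normc.normc (- x) = Normc.normc x.
Proof. exact: normcN. Qed.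

Lemma normcX (R : realType) (z : R[i]) k :
  Normc.normc (z ^+ k) = Normc.normc z ^+ k.
Proof.
elim: k => [|k IH]; first exact: Normc.normc1.
by rewrite !exprS Normc.normcM IH.
Qed.

Lemma normc_real (R : realType) (a : R) : Normc.normc (a%:C)%C = `|a|.
Proof. by rewrite /= expr0n addr0 sqrtr_sqr. Qed.

Lemma normc_imag (R : realType) (a : R) : Normc.normc (0 +i* a)%C = `|a|.
Proof. by rewrite /= expr0n add0r sqrtr_sqr. Qed.

Lemma cexpD (R : realType) (a b : R[i]) : cexp (a + b) = cexp a * cexp b.
Proof.
case: a => a1 a2; case: b => b1 b2; rewrite /cexp /= expRD cosD sinD.
by apply/eqP; rewrite eq_complex /=; apply/andP; split; apply/eqP; ring.
Qed.

Lemma cexp0 (R : realType) : cexp (0 : R[i]) = 1.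
Proof. by rewrite /cexp /= expR0 cos0 sin0 mulr1 mulr0. Qed.

Lemma normc_cexp (R : realType) (z : R[i]) :
  Normc.normc (cexp z) = expR (complex.Re z).
Proof.
rewrite /cexp /= !exprMn -mulrDr cos2Dsin2 mulr1 sqrtr_sqr.
by rewrite ger0_norm // expR_ge0.
Qed.

(** With r the modulus of w, r sin (acos (Re w / r)) is |Im w|; the sign chosen in [clog] restores
    Im w. *)
Lemma cexp_clog (R : realType) (w : R[i]) : w != 0 -> cexp (clog w) = w.
Proof.
move=> w0; have r0 : 0 < Normc.normc w.
  rewrite lt_neqAle normc_ge0 andbT eq_sym; apply: contra w0 => /eqP.
  by move/Normc.eq0_normc ->.
have := r0; rewrite /clog /cexp /= lnK ?posrE // => _.
set r := Normc.normc w in r0 *.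
have Er : r ^+ 2 = complex.Re w ^+ 2 + complex.Im w ^+ 2.
  by rewrite /r; case: (w) => a b /=; rewrite sqr_sqrtr // addr_ge0 ?sqr_ge0.
have h : -1 <= complex.Re w / r <= 1.
  rewrite -ler_norml normrM normfV (gtr0_norm r0) ler_pdivrMr // mul1r.
  exact: normr_Re_le.
have Ec : cos (acos (complex.Re w / r)) = complex.Re w / r.
  by rewrite acosK // in_itv.
have Es : r * sin (acos (complex.Re w / r)) = `|complex.Im w|.
  rewrite sin_acos // -{1}(ger0_norm (ltW r0)) -sqrtr_sqr -sqrtrM ?sqr_ge0 //.
  rewrite mulrBr mulr1 exprMn exprVn mulrCA mulfV ?mulr1; last first.
    by rewrite expf_neq0 // gt_eqF.
  by rewrite Er addrAC subrr add0r sqrtr_sqr.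
case: (w) Ec Es => a b /= Ec Es; apply/eqP; rewrite eq_complex /=.
case: (lerP 0 b) => b0.
  by rewrite Ec Es ger0_norm // mulrC divfK ?lt0r_neq0 // !eqxx.
by rewrite cosN sinN mulrN Ec Es ltr0_norm // opprK mulrC divfK ?lt0r_neq0 // !eqxx.
Qed.

(** The derivative in a real variable is taken componentwise, which makes the real mean value
    theorem applicable. *)
Definition is_cderive (R : realType) (h h' : R -> R[i]) : Prop := forall s : R,
  is_derive s (1 : R) (fun x : R => complex.Re (h x)) (complex.Re (h' s)) /\
  is_derive s (1 : R) (fun x : R => complex.Im (h x)) (complex.Im (h' s)).

Lemma is_cderiveB (R : realType) (f f' g g' : R -> R[i]) :
  is_cderive f f' -> is_cderive g g' ->
  is_cderive (fun s => f s - g s) (fun s => f' s - g' s).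
Proof.
move=> df dg s; have [a b] := df s; have [a' b'] := dg s; split.
  under eq_fun do rewrite raddfB /=.
  by rewrite raddfB /=; apply: is_deriveB.
under eq_fun do rewrite raddfB /=.
by rewrite raddfB /=; apply: is_deriveB.
Qed.

Lemma is_cderiveD (R : realType) (f f' g g' : R -> R[i]) :
  is_cderive f f' -> is_cderive g g' ->
  is_cderive (fun s => f s + g s) (fun s => f' s + g' s).
Proof.
move=> df dg s; have [a b] := df s; have [a' b'] := dg s; split.
  under eq_fun do rewrite raddfD /=.
  by rewrite raddfD /=; apply: is_deriveD.
under eq_fun do rewrite raddfD /=.
by rewrite raddfD /=; apply: is_deriveD.
Qed.

Lemma is_cderive_monomial (R : realType) (a : R[i]) k :
  is_cderive (fun s : R => (s ^+ k)%:C%C * a)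
    (fun s => (k%:R * s ^+ k.-1)%:C%C * a).
Proof.
have D (c s : R) : is_derive s (1 : R) (fun x : R => x ^+ k * c)
    (k%:R * s ^+ k.-1 * c).
  have -> : (fun x : R => x ^+ k * c) = c *: (id ^+ k).
    by apply/funext => x; rewrite mulrC /= fctE.
  apply: is_derive_eq (is_deriveZ c (is_deriveX k (is_derive_id s (1 : R)))) _.
  by rewrite /GRing.scale /= mulr1 mulrC.
case: a => a b s; split => /=.
  by under eq_fun do rewrite mul0r subr0; rewrite mul0r subr0.
by under eq_fun do rewrite mul0r addr0; rewrite mul0r addr0.
Qed.

Lemma is_cderive_cexp (R : realType) (w : R[i]) :
  is_cderive (fun s : R => cexp (s%:C%C * w)) (fun s => w * cexp (s%:C%C * w)).
Proof.
case: w => a b s; rewrite /cexp /=.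
have DM (c : R) : is_derive s 1 (fun x => x * c) c.
  have := is_deriveZ c (is_derive_id s (1 : R)).
  rewrite /GRing.scale /= mulr1 => H.
  by under eq_fun do rewrite mulrC.
have De := @is_derive1_comp R expR (fun x => x * a) s _ _ (is_derive_expR _) (DM a).
have Dc := @is_derive1_comp R cos (fun x => x * b) s _ _ (is_derive_cos _) (DM b).
have Ds := @is_derive1_comp R sin (fun x => x * b) s _ _ (is_derive_sin _) (DM b).
split.
  under eq_fun do rewrite !mul0r subr0 addr0.
  apply: is_derive_eq (is_deriveM De Dc) _.
  by rewrite /GRing.scale /= !mul0r subr0 addr0; ring.
under eq_fun do rewrite !mul0r subr0 addr0.
apply: is_derive_eq (is_deriveM De Ds) _.
by rewrite /GRing.scale /= !mul0r subr0 addr0; ring.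
Qed.

(* The factor 2 comes from applying the mean value theorem separately to the
   real and imaginary parts. *)
Lemma cderive_bound (R : realType) (h h' : R -> R[i]) (s M : R) :
  is_cderive h h' -> 0 <= s <= 1 -> h 0 = 0 ->
  (forall x, 0 <= x <= 1 -> Normc.normc (h' x) <= M) ->
  Normc.normc (h s) <= 2 * M.
Proof.
move=> dh /andP[s0 s1] h0 hM.
have part (f f' : R -> R) :
    (forall x : R, is_derive x (1 : R) f (f' x)) -> f 0 = 0 ->
    (forall x, 0 <= x <= 1 -> `|f' x| <= M) -> `|f s| <= M.
  move=> df f0 fM; have [|c] := @MVT_segment R f f' 0 s s0 (fun x _ => df x).
    apply: derivable_within_continuous => x _.
    exact: (@ex_derive _ _ _ _ _ _ _ (df x)).
  rewrite in_itv /= => /andP[c0 cs]; rewrite f0 !subr0 => ->.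
  rewrite normrM (ger0_norm s0) -[leRHS]mulr1 ler_pM //.
  by rewrite fM // c0 (le_trans cs).
rewrite (le_trans (normc_le_ReIm _)) // mulrDl mul1r lerD //.
  apply: (part (fun x => complex.Re (h x)) (fun x => complex.Re (h' x))) => [x||x x01].
  - exact: (dh x).1.
  - by rewrite h0.
  - by rewrite (le_trans (normr_Re_le _)) ?hM.
apply: (part (fun x => complex.Im (h x)) (fun x => complex.Im (h' x))) => [x||x x01].
- exact: (dh x).2.
- by rewrite h0.
- by rewrite (le_trans (normr_Im_le _)) ?hM.
Qed.

Definition cexp_poly (R : realType) (m : nat) (w : R[i]) : R[i] :=
  \sum_(j < m) w ^+ j / (j`!)%:R.

Lemma is_cderive_cexp_poly (R : realType) (w : R[i]) m :
  is_cderive (fun s : R => cexp_poly m.+1 (s%:C%C * w))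
    (fun s => w * cexp_poly m (s%:C%C * w)).
Proof.
elim: m => [|m IH].
  move=> s; rewrite /cexp_poly big_ord0 mulr0.
  under eq_fun do rewrite big_ord1 expr0 fact0 divr1.
  under [in X in _ /\ X]eq_fun do rewrite big_ord1 expr0 fact0 divr1.
  by split; apply: is_derive_cst.
have -> : (fun s : R => cexp_poly m.+2 (s%:C%C * w)) =
    (fun s : R => cexp_poly m.+1 (s%:C%C * w) +
      (s ^+ m.+1)%:C%C * (w ^+ m.+1 / (m.+1`!)%:R)).
  apply/funext => s; rewrite /cexp_poly big_ord_recr /=; congr (_ + _).
  by rewrite exprMn rmorphXn mulrA.
have -> : (fun s : R => w * cexp_poly m.+1 (s%:C%C * w)) =
    (fun s : R => w * cexp_poly m (s%:C%C * w) +
      (m.+1%:R * s ^+ m)%:C%C * (w ^+ m.+1 / (m.+1`!)%:R)).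
  apply/funext => s; rewrite /cexp_poly big_ord_recr /= mulrDr; congr (_ + _).
  rewrite exprMn rmorphM /= rmorphXn rmorph_nat exprS factS natrM.
  have : m.+1%:R != 0 :> R[i] by rewrite pnatr_eq0.
  have : m`!%:R != 0 :> R[i] by rewrite pnatr_eq0 -lt0n fact_gt0.
  move: (m.+1%:R : R[i]) (m`!%:R : R[i]) => c f f0 c0.
  by field; rewrite f0 c0.
by apply: is_cderiveD => //; exact: (is_cderive_monomial _ m.+1).
Qed.

(** Along the segment s w with s in [0, 1], the remainder of order m + 1 vanishes at s = 0 and has
    derivative w times the remainder of order m, so each induction step costs a factor 2 |w|. *)
Lemma cexp_taylor (R : realType) (w : R[i]) m :
  Normc.normc (cexp w - cexp_poly m w) <=
    (2 * Normc.normc w) ^+ m * expR `|complex.Re w|.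
Proof.
have H (s : R) : 0 <= s <= 1 ->
    Normc.normc (cexp (s%:C%C * w) - cexp_poly m (s%:C%C * w)) <=
    (2 * Normc.normc w) ^+ m * expR `|complex.Re w|.
  elim: m s => [|m IH] s s01.
    rewrite /cexp_poly big_ord0 subr0 expr0 mul1r normc_cexp ler_expR.
    case: w => a b /=; rewrite mul0r subr0 (le_trans (ler_norm _)) // normrM.
    by case/andP: s01 => s0 s1; rewrite ger0_norm // ler_piMl.
  rewrite exprS -!mulrA; apply: (@cderive_bound _
    (fun x : R => cexp (x%:C%C * w) - cexp_poly m.+1 (x%:C%C * w))
    (fun x : R => w * cexp (x%:C%C * w) - w * cexp_poly m (x%:C%C * w)) s _ _ s01).
  - apply: is_cderiveB; first exact: is_cderive_cexp.
    exact: is_cderive_cexp_poly.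
  - rewrite mul0r cexp0 /cexp_poly big_ord_recl expr0 fact0 divr1 big1 ?addr0 ?subrr //.
    by move=> j _; rewrite lift0 expr0n mul0r.
  move=> x x01 /=; rewrite -mulrBr Normc.normcM ler_wpM2l ?normc_ge0 //.
  exact: IH.
by have := H 1; rewrite rmorph1 mul1r ler01 lexx; apply.
Qed.

(* Removing the last Taylor term trades one power of w for boundedness. *)
Lemma cexp_taylor_imag (R : realType) (y : R) m :
  Normc.normc (cexp (0 +i* y)%C - cexp_poly m.+1 (0 +i* y)%C) <=
    (2 ^+ m + 1) * `|y| ^+ m.
Proof.
have := cexp_taylor (0 +i* y)%C m; rewrite normc_imag /= normr0 expR0 mulr1 => H.
rewrite /cexp_poly big_ord_recr /= opprD addrA (le_trans (normc_triangle _ _)) //.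
rewrite mulrDl mul1r -exprMn lerD // normc_opp Normc.normcM normcX normc_imag.
rewrite Normc.normcV ler_piMr ?exprn_ge0 //.
rewrite -[_%:R](rmorph_nat (real_complex R)) normc_real normr_nat.
by rewrite invf_le1 ?ltr0n ?fact_gt0 // ler1n fact_gt0.
Qed.

(** * Little-o remainders and local expansions along the imaginary axis *)

Definition osmall (R : realType) (n : nat) (g : R -> R[i]) : Prop :=
  forall e : R, 0 < e ->
    \forall t \near (0 : R)^', Normc.normc (g t) <= e * `|t| ^+ n.

Lemma osmallP (R : realType) (n : nat) (g : R -> R[i]) :
  osmall n g <->
  (Normc.normc (g t) / `|t| ^+ n) @[t --> (0 : R)^'] --> (0 : R).
Proof.
rewrite cvgr0Pnorm_le; split => H e e0; near=> t;
  have t0 : 0 < `|t| ^+ n by rewrite exprn_gt0 // normr_gt0; near: t;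
    exact: nbhs_dnbhs_neq.
  rewrite ger0_norm ?divr_ge0 ?normc_ge0 ?(ltW t0) // ler_pdivrMr //.
  by near: t; apply: H.
rewrite -ler_pdivrMr // -[leLHS]ger0_norm ?divr_ge0 ?normc_ge0 ?(ltW t0) //.
by near: t; apply: H.
Unshelve. all: by end_near. Qed.

Lemma osmallD (R : realType) n (f g : R -> R[i]) :
  osmall n f -> osmall n g -> osmall n (fun t => f t + g t).
Proof.
move=> sf sg e e0; near=> t; rewrite (le_trans (normc_triangle _ _)) //.
rewrite [e]splitr mulrDl lerD //; near: t; [apply: sf|apply: sg];
  by rewrite divr_gt0.
Unshelve. all: by end_near. Qed.

Lemma osmall_le (R : realType) n (K : R) (f g : R -> R[i]) : 0 < K ->
  (\forall t \near (0 : R)^', Normc.normc (g t) <= K * Normc.normc (f t)) ->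
  osmall n f -> osmall n g.
Proof.
move=> K0 gf sf e e0; near=> t.
apply: (@le_trans _ _ (K * Normc.normc (f t))); first by near: t.
by rewrite -ler_pdivlMl // mulrA [_ * e]mulrC; near: t; apply: sf; rewrite divr_gt0.
Unshelve. all: by end_near. Qed.

Lemma osmallN (R : realType) n (f : R -> R[i]) :
  osmall n f -> osmall n (fun t => - f t).
Proof.
by apply: osmall_le ltr01 _; near=> t; rewrite mul1r normc_opp.
Unshelve. all: by end_near. Qed.

Lemma osmall_bigO (R : realType) n (K : R) (f : R -> R[i]) :
  (\forall t \near (0 : R)^', Normc.normc (f t) <= K * `|t| ^+ n.+1) ->
  osmall n f.
Proof.
move=> fK e e0; near=> t.
apply: (@le_trans _ _ (K * `|t| ^+ n.+1)); first by near: t.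
rewrite exprS mulrA ler_wpM2r ?exprn_ge0 //.
apply: (@le_trans _ _ ((`|K| + 1) * `|t|)).
  by rewrite ler_wpM2r // (le_trans (ler_norm _)) // lerDl.
have K1 : 0 < `|K| + 1 by rewrite ltr_wpDl.
rewrite -ler_pdivlMl // ltW //; near: t; apply: dnbhs0_lt.
by rewrite mulr_gt0 // invr_gt0.
Unshelve. all: by end_near. Qed.

Lemma osmall_weak (R : realType) n m (f : R -> R[i]) :
  (m <= n)%N -> osmall n f -> osmall m f.
Proof.
move=> mn sf e e0; near=> t.
apply: (@le_trans _ _ (e * `|t| ^+ n)); first by near: t; apply: sf.
rewrite ler_pM2l // ler_wiXn2l //; near: t; exact: dnbhs0_le.
Unshelve. all: by end_near. Qed.

Lemma horner_bound (R : realType) m (p : {poly R[i]}) : eqmodX m p 0 ->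
  exists2 K : R, 0 < K & forall t : R, `|t| <= 1 ->
    Normc.normc p.[(0 +i* t)%C] <= K * `|t| ^+ m.
(* The summand 1 keeps the constant positive even for p = 0. *)
Proof.
move=> pm; exists (1 + \sum_(i < size p) Normc.normc p`_i).
  by rewrite ltr_wpDr // sumr_ge0 // => i _; apply: normc_ge0.
move=> t t1; rewrite horner_coef mulrDl mul1r mulr_suml.
suff H : Normc.normc (\sum_(i < size p) p`_i * (0 +i* t)%C ^+ i) <=
    \sum_(i < size p) Normc.normc p`_i * `|t| ^+ m.
  by rewrite (le_trans H) // lerDr exprn_ge0.
apply: (big_ind2 (fun (x : R[i]) (y : R) => Normc.normc x <= y)).
- by rewrite Normc.normc0.
- by move=> a b c d ab cd; rewrite (le_trans (normc_triangle _ _)) // lerD.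
move=> i _; rewrite Normc.normcM normcX normc_imag.
have [im|mi] := ltnP i m.
  by rewrite pm // coef0 Normc.normc0 !mul0r.
by rewrite ler_wpM2l ?normc_ge0 // ler_wiXn2l.
Qed.

(** The real part is handled by continuity of [ln] at 1, the argument through its cosine: for w = a
    + i b of modulus r, an argument above e' forces a < r cos e', which fails when a and r are both
    close to 1. *)
Lemma clog_near1 (R : realType) (e : R) : 0 < e ->
  exists2 d : R, 0 < d & forall w : R[i], Normc.normc (w - 1) < d ->
    Normc.normc (clog w) <= e.
Proof.
(* The cap at pi keeps e' where [cos] is strictly decreasing. *)
move=> e0; pose e' := Num.min (e / 2) pi.
have e'0 : 0 < e' by rewrite lt_min divr_gt0 //= pi_gt0.
have e'pi : e' <= pi by rewrite ge_min lexx orbT.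
have e'e : e' <= e / 2 by rewrite ge_min lexx.
have c1 : cos e' < 1.
  by rewrite -[ltRHS](@cos0 R) ltr_cos // in_itv /= ?lexx ?pi_ge0 // (ltW e'0).
have [d1 d10 Hd1] : exists2 d : R, 0 < d &
    forall r : R, `|r - 1| < d -> `|ln r| <= e / 2.
  have := @continuous_ln R 1 ltr01; move/cvgrPdist_le => /(_ (e / 2)).
  rewrite divr_gt0 // => /(_ isT) /nbhs_ballP [d /= d0 H]; exists d => // r rd.
  by have := H r; rewrite /ball /= distrC => /(_ rd); rewrite ln1 sub0r normrN.
(* The three radii serve to bound [ln r], to keep r positive, and to contradict 1 - N < cos e' + N,
   where N is the distance from w to 1. *)
exists (Num.min d1 (Num.min (1 / 2) ((1 - cos e') / 2))).
  by rewrite !lt_min d10 /= !divr_gt0 // subr_gt0.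
case=> a b; rewrite !lt_min => /and3P[wd1 wd2 wd3].
set r : R := Normc.normc (a +i* b)%C.
have r1 : `|r - 1| <= Normc.normc ((a +i* b)%C - 1).
  rewrite ler_norml; apply/andP; split.
    rewrite lerNl opprB lerBlDr -[X in X <= _](Normc.normc1 R).
    rewrite -[X in X + _]normc_opp opprB (le_trans _ (normc_triangle _ _)) //.
    by rewrite subrK.
  rewrite lerBlDr -[X in _ + X](Normc.normc1 R) (le_trans _ (normc_triangle _ _)) //.
  by rewrite subrK.
have a1 : `|a - 1| <= Normc.normc ((a +i* b)%C - 1).
  by have := normr_Re_le ((a +i* b)%C - 1).
move: r1 a1 wd1 wd2 wd3; set N : R := Normc.normc (_ - 1) => r1 a1 wd1 wd2 wd3.
have N0 : 0 <= N := normc_ge0 _.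
have Hpos (x y : R) : y < 1 / 2 -> - y <= x - 1 -> 0 < x by lra.
have r0 : 0 < r by move: r1; rewrite ler_norml => /andP[+ _]; apply: Hpos.
rewrite (le_trans (normc_le_ReIm _)) // [e]splitr lerD //=.
  by apply: Hd1; rewrite (le_lt_trans r1).
have h : -1 <= a / r <= 1.
  rewrite -ler_norml normrM normfV (gtr0_norm r0) ler_pdivrMr // mul1r.
  exact: (normr_Re_le (a +i* b)%C).
rewrite (_ : `|_| = acos (a / r)); last first.
  by rewrite -/(Normc.normc (a +i* b)%C) -/r; case: ifP => _;
    rewrite ?normrN ger0_norm // acos_ge0.
apply: le_trans e'e; rewrite leNgt; apply/negP => H.
have : cos (acos (a / r)) < cos e'.
  rewrite ltr_cos // in_itv /= ?acos_ge0 ?acos_lepi //.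
  by rewrite (ltW e'0).
rewrite acosK ?in_itv // ltr_pdivrMr // => acr.
have : cos e' * (r - 1) <= N.
  rewrite (le_trans (ler_norm _)) // normrM -[leRHS]mul1r ler_pM //.
  exact: cos_max.
move: a1 acr wd3; rewrite ler_norml => /andP[a1 _]; rewrite mulrBr mulr1.
have Hcontra (x c cr y : R) :
  - y <= x - 1 -> x < cr -> y < (1 - c) / 2 -> cr - c <= y -> False by lra.
exact: Hcontra.
Qed.

Notation realC := (real_complex _).

(** Quantitative injectivity of the exponential at 0, from cexp z - 1 = z + O(z^2). It bounds a
    difference of logarithms by the deviation of its exponential from 1. *)
Lemma cexp_inv_bound (R : realType) : exists2 eta : R, 0 < eta &
  forall z : R[i], Normc.normc z <= eta ->
    Normc.normc z <= 2 * Normc.normc (cexp z - 1).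
Proof.
have e0 : 0 < expR (1 : R) := expR_gt0 _.
have e1 : 1 <= expR (1 : R) by rewrite -[leLHS](@expR0 R) ler_expR.
(* With x = |z| <= 1, the second-order remainder is at most (2 x)^2 e, which is at most x / 2 as
   soon as x <= 1 / (8 e). *)
exists (8 * expR 1)^-1; first by rewrite invr_gt0 mulr_gt0.
move=> z zeta; have := cexp_taylor z 2.
have -> : cexp_poly 2 z = 1 + z.
  by rewrite /cexp_poly !big_ord_recr big_ord0 /= add0r expr0 expr1 !divr1.
set x := Normc.normc z in zeta *; set y : R := Normc.normc (cexp z - 1).
have x0 : 0 <= x := normc_ge0 z.
have x1 : x <= 1.
  rewrite (le_trans zeta) // invf_le1 ?mulr_gt0 //.
  by rewrite -[leLHS]mulr1 ler_pM // ?ler1n.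
have ex : expR `|complex.Re z| <= expR 1.
  by rewrite ler_expR (le_trans (normr_Re_le z)).
have xy : x - y <= Normc.normc (cexp z - (1 + z)).
  rewrite lerBlDr /x {1}(_ : z = - (cexp z - (1 + z)) + (cexp z - 1)); last by ring.
  by rewrite (le_trans (normc_triangle _ _)) // normc_opp.
move=> /(le_trans xy) {}xy.
have : x - y <= x / 2.
  apply: (le_trans xy); apply: (@le_trans _ _ ((2 * x) ^+ 2 * expR 1)).
    by rewrite ler_wpM2l // sqr_ge0.
  rewrite (_ : _ * _ = x * (4 * expR 1 * x)); last by ring.
  rewrite ler_wpM2l //; move: zeta; rewrite -[_^-1]mul1r ler_pdivlMr ?mulr_gt0 //.
  have L (a e : R) : a * (8 * e) <= 1 -> 4 * e * a <= 2^-1 by lra.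
  exact: L.
have L (a b : R) : a - b <= a / 2 -> a <= 2 * b by lra.
exact: L.
Qed.

Lemma map_fexp_horner (R : realType) n (a : {poly R}) (z : R[i]) :
  (map_poly realC (fexp n a)).[z] = cexp_poly n.+1 (map_poly realC a).[z].
Proof.
rewrite /fexp /cexp_poly rmorph_sum horner_sum; apply: eq_bigr => j _ /=.
by rewrite map_polyZ hornerZ rmorphXn horner_exp fmorphV rmorph_nat mulrC.
Qed.

Lemma map_eqmodX (R : realType) n (a b : {poly R}) :
  eqmodX n a b -> eqmodX n (map_poly realC a) (map_poly realC b).
Proof. by move=> ab i im; rewrite !coef_map ab. Qed.

(** Two errors, both O(t^(n+1)): the Taylor remainder of [cexp] at a logarithm of size O(t), and the
    coefficients above degree n by which [fexp n (flog1p n u)] differs from 1 + u. *)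
Lemma cexp_flog1p_expansion (R : realType) n (u : {poly R}) : u`_0 = 0 ->
  osmall n (fun t : R => cexp (map_poly realC (flog1p n u)).[(0 +i* t)%C]
    - (map_poly realC (1 + u)).[(0 +i* t)%C]).
Proof.
move=> u0; pose L := map_poly realC (flog1p n u).
have L1 : eqmodX 1 L 0.
  case=> // _; rewrite coef_map coef0_flog1p //= coef0.
  exact: (rmorph0 realC).
have [K K0 LK] := horner_bound L1.
have [K' K'0 LK'] : exists2 K : R, 0 < K & forall t : R, `|t| <= 1 ->
    Normc.normc ((map_poly realC (fexp n (flog1p n u))).[(0 +i* t)%C] -
       (map_poly realC (1 + u)).[(0 +i* t)%C]) <= K * `|t| ^+ n.+1.
  have H : eqmodX n.+1 (map_poly realC (fexp n (flog1p n u))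
       - map_poly realC (1 + u)) 0.
    move=> i im; rewrite coefB coef0; apply/eqP; rewrite subr_eq0; apply/eqP.
    by apply: map_eqmodX im; apply: fexp_flog1p.
  have [K1 K10 HK] := horner_bound H; exists K1 => // t t1.
  by rewrite -hornerN -hornerD; apply: HK.
apply: (@osmall_bigO _ _ ((2 * K) ^+ n.+1 * expR K + K')); near=> t.
have t1 : `|t| <= 1 by near: t; apply: dnbhs0_le.
set z := (0 +i* t)%C; have Lz : Normc.normc L.[z] <= K * `|t| := LK t t1.
rewrite -/L; set P := (map_poly realC (1 + u)).[z].
have -> : cexp L.[z] - P = (cexp L.[z] - cexp_poly n.+1 L.[z]) +
    (cexp_poly n.+1 L.[z] - P) by ring.
rewrite (le_trans (normc_triangle _ _)) // mulrDl lerD //; last first.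
  by rewrite -map_fexp_horner; apply: LK'.
rewrite (le_trans (cexp_taylor _ _)) // mulrAC -exprMn ler_pM ?expR_ge0 //.
- by rewrite exprn_ge0 // mulr_ge0 // normc_ge0.
- by rewrite lerXn2r ?nnegrE ?mulr_ge0 ?normc_ge0 ?(ltW K0) // -mulrA ler_wpM2l.
rewrite ler_expR (le_trans (normr_Re_le _)) // (le_trans Lz) //.
by rewrite ler_piMr // ltW.
Unshelve. all: by end_near. Qed.

(** With L the polynomial logarithm and D = clog phi - L, one has cexp D - 1 = cexp (- L) (phi -
    cexp L), which is o(t^n). As clog phi and L both tend to 0, D is eventually small enough for
    [cexp_inv_bound], which rules out a difference of 2 pi i between branches. *)
Lemma clog_expansion (R : realType) n (u : {poly R}) (phi : R -> R[i]) :
  u`_0 = 0 ->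
  osmall n (fun t => phi t - (map_poly realC (1 + u)).[(0 +i* t)%C]) ->
  osmall n (fun t => clog (phi t)
    - (map_poly realC (flog1p n u)).[(0 +i* t)%C]).
Proof.
move=> u0 phiu; pose L t := (map_poly realC (flog1p n u)).[(0 +i* t)%C].
have L1 : eqmodX 1 (map_poly realC (flog1p n u)) 0.
  case=> // _; rewrite coef_map coef0_flog1p //= coef0.
  exact: (rmorph0 realC).
have [K K0 LK] := horner_bound L1.
have u1 : eqmodX 1 (map_poly realC u) 0.
  case=> // _; rewrite coef_map u0 /= coef0.
  exact: (rmorph0 realC).
have [K' K'0 uK] := horner_bound u1.
have phiL : osmall n (fun t => phi t - cexp (L t)).
  have := osmallD phiu (osmallN (cexp_flog1p_expansion n u0)).
  apply: (osmall_le ltr01); near=> t; rewrite mul1r /L.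
  set a := (map_poly _ (1 + u)).[_]; set b := cexp _.
  by rewrite [X in _ <= Normc.normc X](_ : _ = phi t - b) //; ring.
have small_cvg (f : R -> R[i]) e : 0 < e -> osmall 0 f ->
    \forall t \near (0 : R)^', Normc.normc (f t) <= e.
  by move=> e0 /(_ _ e0); apply: filterS => t; rewrite expr0 mulr1.
have small_lin (f : R -> R[i]) C : 0 < C ->
    (forall t, `|t| <= 1 -> Normc.normc (f t) <= C * `|t| ^+ 1) -> osmall 0 f.
  move=> C0 fC; apply: (@osmall_bigO _ _ C); near=> t; apply: fC.
  by near: t; apply: dnbhs0_le.
have L0 : osmall 0 L := small_lin _ _ K0 LK.
have phi1 : osmall 0 (fun t => phi t - 1).
  have := osmallD (osmall_weak (leq0n n) phiu) (small_lin _ _ K'0 uK).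
  apply: (osmall_le ltr01); near=> t; rewrite mul1r.
  rewrite rmorphD rmorph1 /= hornerD hornerC.
  by rewrite [X in _ <= Normc.normc X](_ : _ = phi t - 1) //; ring.
have [eta eta0 Heta] := cexp_inv_bound R.
have [d d0 Hd] := @clog_near1 R (eta / 2) (divr_gt0 eta0 (ltr0Sn _ 1)).
(* The 2 comes from [cexp_inv_bound]; [expR 1] bounds the modulus of cexp (- L) once |L| <= 1. *)
apply: (@osmall_le _ _ (2 * expR 1) _ _ _ _ phiL).
  by rewrite mulr_gt0 // expR_gt0.
near=> t; rewrite -/(L t).
have phi_d : Normc.normc (phi t - 1) < d.
  apply: (@le_lt_trans _ _ (d / 2)); last by rewrite ltr_pdivrMr // ltr_pMr // ltr1n.
  by near: t; apply: small_cvg => //; rewrite divr_gt0.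
have phi_1 : Normc.normc (phi t - 1) <= 1 / 2.
  by near: t; apply: small_cvg => //; rewrite divr_gt0.
have Lt : Normc.normc (L t) <= Num.min 1 (eta / 2).
  by near: t; apply: small_cvg => //; rewrite lt_min ltr01 /= divr_gt0.
have phi_neq0 : phi t != 0.
  apply/eqP => phi0; move: phi_1; rewrite phi0 sub0r normc_opp Normc.normc1.
  by rewrite ler_pdivlMr // mul1r lern1.
have de : Normc.normc (clog (phi t) - L t) <= eta.
  rewrite (le_trans (normc_triangle _ _)) // normc_opp [eta]splitr lerD //.
    exact: Hd.
  by move: Lt; rewrite le_min => /andP[].
rewrite (le_trans (Heta _ de)) // -mulrA ler_wpM2l //.
have -> : cexp (clog (phi t) - L t) - 1 = cexp (- L t) * (phi t - cexp (L t)).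
  rewrite mulrBr -cexpD addNr cexp0 cexpD cexp_clog //.
  by rewrite [phi t * _]mulrC.
rewrite Normc.normcM ler_wpM2r ?normc_ge0 // normc_cexp ler_expR.
rewrite (le_trans (ler_norm _)) // (le_trans (normr_Re_le _)) // normc_opp.
by move: Lt; rewrite le_min => /andP[].
Unshelve. all: by end_near. Qed.

Lemma osmall_cst (R : realType) (c : R[i]) : osmall 0 (fun _ : R => c) -> c = 0.
Proof.
move=> oc; apply: Normc.eq0_normc.
apply/eqP; rewrite eq_le normc_ge0 andbT leNgt; apply/negP => c0.
have [|t] := @filter_ex _ (0 : R)^' _ _ (oc (Normc.normc c / 2) _).
  by rewrite divr_gt0.
by rewrite expr0 mulr1 ler_pdivlMr // ger_pMr // lern1.
Qed.

(** The source of uniqueness of cumulants. The constant coefficient is the limit at 0, hence 0;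
    dividing by the variable then lowers the degree and the order of smallness together. *)
Lemma osmall_poly_eq0 (R : realType) n (p : {poly R[i]}) : (size p <= n.+1)%N ->
  osmall n (fun t : R => p.[(0 +i* t)%C]) -> p = 0.
Proof.
elim: n p => [|n IH] p sp op.
  move: op; rewrite (size1_polyC sp) => op; congr (_ %:P); apply: osmall_cst.
  by move=> e e0; have := op e e0; apply: filterS => t; rewrite hornerC.
have p0 : p`_0 = 0.
  have p1 : eqmodX 1 (p - (p`_0)%:P) 0.
    by case=> // _; rewrite coefB coefC eqxx subrr coef0.
  have [K K0 HK] := horner_bound p1.
  have o1 : osmall 0 (fun t : R => (p - (p`_0)%:P).[(0 +i* t)%C]).
    apply: (@osmall_bigO _ _ K); near=> t; apply: HK.
    by near: t; apply: dnbhs0_le.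
  apply: osmall_cst; have := osmallD (osmall_weak (leq0n _) op) (osmallN o1).
  apply: (osmall_le ltr01); near=> t; rewrite mul1r hornerD hornerN hornerC.
  by rewrite opprB addrCA subrr addr0.
pose q := drop_poly 1 p.
have pq : p = 'X * q.
  rewrite mulrC -[in LHS](poly_take_drop 1 p) expr1.
  suff -> : take_poly 1 p = 0 by rewrite add0r.
  by apply/polyP => -[|j]; rewrite coef_take_poly coef0 ?p0.
suff q0 : q = 0 by rewrite pq q0 mulr0.
apply: IH; first by rewrite size_drop_poly leq_subLR.
move=> e e0; near=> t.
have t0 : 0 < `|t| by rewrite normr_gt0; near: t; exact: nbhs_dnbhs_neq.
rewrite -(ler_pM2l t0) mulrCA -exprS -normc_imag -Normc.normcM.
rewrite -[X in X * _]hornerX -hornerM -pq normc_imag.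
by near: t; apply: op.
Unshelve. all: by end_near. Qed.

(** * Characteristic functions and cumulants *)

Lemma fine_expectation d (T : measurableType d) (R : realType)
    (P : probability T R) (X : T -> R) :
  fine 'E_P[X] = (\int[P]_(w in setT) X w)%R.
Proof. by rewrite unlock. Qed.

Lemma integrable_expr_le d (T : measurableType d) (R : realType)
    (P : probability T R) (X : T -> R) n k :
  measurable_fun setT X -> P.-integrable setT (EFin \o (fun w => `|X w| ^+ n)) ->
  (k <= n)%N -> P.-integrable setT (EFin \o (fun w => X w ^+ k)).
Proof.
move=> mX iX kn.
have i1 : P.-integrable setT (EFin \o (fun w => 1 + `|X w| ^+ n)).
  have := integrableD measurableT
    (finite_measure_integrable_cst P 1 measurableT) iX.
  exact.
apply: (le_integrable measurableT _ _ i1).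
  by apply/measurable_EFinP; exact: measurable_funX.
move=> w _ /=; rewrite lee_fin normrX [leRHS]ger0_norm ?addr_ge0 ?exprn_ge0 //.
have [X1|/ltW X1] := lerP `|X w| 1.
  by rewrite (le_trans (exprn_ile1 _ _ X1)) // lerDl exprn_ge0.
by rewrite (le_trans (ler_weXn2l X1 kn)) // lerDr.
Qed.

Lemma Rintegral_lincomb d (T : measurableType d) (R : realType)
    (P : probability T R) (a : nat -> R) (h : nat -> T -> R) m :
  (forall k, (k < m)%N -> P.-integrable setT (EFin \o h k)) ->
  P.-integrable setT (EFin \o (fun w => \sum_(k < m) a k * h k w)) /\
  (\int[P]_(w in setT) (\sum_(k < m) a k * h k w))%R =
    \sum_(k < m) a k * (\int[P]_(w in setT) h k w)%R.
Proof.
elim: m => [_|m IH ih].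
  split; last by rewrite big_ord0; under eq_Rintegral do rewrite big_ord0;
    rewrite Rintegral_cst // mul0r.
  rewrite (_ : _ \o _ = cst 0%:E); last by apply/funext => w /=; rewrite big_ord0.
  exact: finite_measure_integrable_cst.
have [k km|i1 E1] := IH; first by apply: ih; rewrite ltnS ltnW.
have i2 : P.-integrable setT (EFin \o (fun w => a m * h m w)).
  have := integrableZl measurableT (a m) (ih m (leqnn _)).
  by apply: eq_integrable => // w _; rewrite /= EFinM.
have E : (fun w => \sum_(k < m.+1) a k * h k w) =
    (fun w => \sum_(k < m) a k * h k w + a m * h m w).
  by apply/funext => w; rewrite big_ord_recr.
rewrite {}E big_ord_recr /= -E1; split.
  have := integrableD measurableT i1 i2; exact.
by rewrite RintegralD // RintegralZl //; exact: ih.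
Qed.

Lemma integrable_horner d (T : measurableType d) (R : realType)
    (P : probability T R) (X : T -> R) n (p : {poly R}) :
  (forall k, (k <= n)%N -> P.-integrable setT (EFin \o (fun w => X w ^+ k))) ->
  (size p <= n.+1)%N ->
  P.-integrable setT (EFin \o (fun w => p.[X w])) /\
  (\int[P]_(w in setT) p.[X w])%R =
    \sum_(k < n.+1) p`_k * (\int[P]_(w in setT) X w ^+ k)%R.
Proof.
move=> iX sp.
have -> : (fun w => p.[X w]) = (fun w => \sum_(k < n.+1) p`_k * X w ^+ k).
  by apply/funext => w; rewrite (horner_coef_wide _ sp).
exact: (Rintegral_lincomb (fun k => p`_k) (h := fun k w => X w ^+ k)).
Qed.

(* [min (`|t * x|, 1)] captures both Taylor bounds [O(x^n)] and [O(x^(n+1))]. *)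
Lemma cexp_taylor_min (R : realType) n : exists2 C : R, 0 < C &
  forall t x : R,
    Normc.normc (cexp (0 +i* (t * x))%C - cexp_poly n.+1 (0 +i* (t * x))%C) <=
    C * `|t| ^+ n * (`|x| ^+ n * Num.min (`|t| * `|x|) 1).
Proof.
(* Large enough for both regimes: 2 ^+ n.+1 from [cexp_taylor] when |t x| <= 1, and 2 ^+ n + 1 from
   [cexp_taylor_imag] otherwise. *)
exists (2 ^+ n.+1 + 1); first by rewrite ltr_wpDl ?exprn_ge0.
move=> t x; set y := t * x.
have -> : (2 ^+ n.+1 + 1) * `|t| ^+ n * (`|x| ^+ n * Num.min (`|t| * `|x|) 1) =
    (2 ^+ n.+1 + 1) * (`|y| ^+ n * Num.min `|y| 1) :> R.
  by rewrite /y normrM exprMn; ring.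
have y0 : 0 <= `|y| ^+ n by rewrite exprn_ge0.
have [y1|/ltW y1] := lerP `|y| 1.
  have := cexp_taylor (0 +i* y)%C n.+1.
  rewrite normc_imag /= normr0 expR0 mulr1 => /le_trans; apply.
  by rewrite exprMn mulrDl mul1r -exprSr lerDl exprn_ge0.
apply: (le_trans (cexp_taylor_imag y n)); rewrite mulr1 ler_wpM2r // lerD2r.
by rewrite ler_eXn2l ?ltr1n.
Qed.

(** Dominated convergence with bound |X|^n gives the limit along t = 1 / (k + 1); the integrand is
    monotone in |t|, so one such k settles all smaller |t|. *)
Lemma min_moment_cvg0 d (T : measurableType d) (R : realType)
    (P : probability T R) (X : T -> R) n :
  measurable_fun setT X -> P.-integrable setT (EFin \o (fun w => `|X w| ^+ n)) ->
  (forall t : R, 0 <= t -> P.-integrable setT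
    (EFin \o (fun w => `|X w| ^+ n * Num.min (t * `|X w|) 1))) /\
  forall e : R, 0 < e -> \forall t \near (0 : R)^',
    (\int[P]_(w in setT) (`|X w| ^+ n * Num.min (`|t| * `|X w|) 1))%R <= e.
Proof.
move=> mX iX; pose G (t : R) w := `|X w| ^+ n * Num.min (t * `|X w|) 1.
have mnX : measurable_fun setT (fun w => `|X w|) by exact: measurableT_comp.
have mG t : measurable_fun setT (G t).
  apply: measurable_funM; first exact: measurable_funX.
  by apply: measurable_minr => //; apply: measurable_funM.
have G0 t w : 0 <= t -> 0 <= G t w.
  by move=> t0; rewrite mulr_ge0 ?exprn_ge0 // le_min ler01 mulr_ge0.
have GX t w : 0 <= t -> `|G t w| <= `|X w| ^+ n.
  by move=> t0; rewrite ger0_norm ?G0 // ler_piMr ?exprn_ge0 // ge_min lexx orbT.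
have iG t : 0 <= t -> P.-integrable setT (EFin \o G t).
  move=> t0; apply: (le_integrable measurableT _ _ iX).
    exact/measurable_EFinP.
  by move=> w _ /=; rewrite lee_fin [leRHS]ger0_norm ?exprn_ge0 // GX.
split=> // e e0.
have Gcvg : (\int[P]_(w in setT) (G k.+1%:R^-1 w)%:E)%E @[k --> \oo] -->
    (\int[P]_(w in setT) (cst 0%E w))%E.
  apply: (dominated_cvg measurableT (g := EFin \o (fun w => `|X w| ^+ n))) => //.
  - by move=> k; apply/measurable_EFinP; apply: mG.
  - move=> w _; apply: cvg_EFin; first exact: nearW.
    apply: (squeeze_cvgr (f := fun=> 0)
        (h := fun k : nat => k.+1%:R^-1 * (`|X w| ^+ n * `|X w|))).
    + near=> k; rewrite G0 ?invr_ge0 //= /G mulrCA ler_wpM2l ?exprn_ge0 //.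
      by rewrite ge_min lexx.
    + exact: cvg_cst.
    + rewrite -[X in _ --> X](mul0r (`|X w| ^+ n * `|X w|)); apply: cvgMl.
      exact: cvg_harmonic.
  - by move=> k w _ /=; rewrite lee_fin GX // invr_ge0.
rewrite integral0 in Gcvg.
have [k _ Hk] : \forall k \near \oo, (\int[P]_(w in setT) G k.+1%:R^-1 w)%R <= e.
  have H0 : (\int[P]_(w in setT) G k.+1%:R^-1 w)%R @[k --> \oo] --> (0 : R).
    exact: fine_cvg Gcvg.
  move/cvgr0Pnorm_le : H0 => /(_ e e0); apply: filterS => k.
  exact: (le_trans (ler_norm _)).
near=> t; apply: le_trans (Hk k (leqnn k)).
apply: le_Rintegral => //; [exact: iG|by apply: iG; rewrite invr_ge0|].
move=> w _; rewrite ler_wpM2l ?exprn_ge0 // le_min !ge_min lexx orbT andbT.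
apply/orP; left; rewrite ler_wpM2r //; near: t; apply: dnbhs0_le.
by rewrite invr_gt0.
Unshelve. all: by end_near. Qed.

(** [part] stands for the real or the imaginary part, since [cexpectation] integrates the two
    separately; only real linearity, domination by the modulus and measurability are required of
    it. *)
Lemma part_expectation_bound d (T : measurableType d) (R : realType)
    (P : probability T R) (X : T -> R) n (part : R[i] -> R) (C t : R) :
  measurable_fun setT X -> P.-integrable setT (EFin \o (fun w => `|X w| ^+ n)) ->
  (forall a b, part (a + b) = part a + part b) ->
  (forall (a : R[i]) (x : R), part (a * x%:C%C) = part a * x) ->
  (forall a, `|part a| <= Normc.normc a) ->
  (forall s, measurable_fun setT (fun x : R => part (cexp (0 +i* (s * x))%C))) ->
  (forall t x : R,
    Normc.normc (cexp (0 +i* (t * x))%C - cexp_poly n.+1 (0 +i* (t * x))%C) <=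
    C * `|t| ^+ n * (`|x| ^+ n * Num.min (`|t| * `|x|) 1)) ->
  `| (\int[P]_(w in setT) part (cexp ((0 +i* t)%C * (X w)%:C%C)))%R
    - part (map_poly realC (\poly_(k < n.+1)
        ((\int[P]_(w in setT) (X w ^+ k))%R / k`!%:R))).[(0 +i* t)%C] | <=
  C * `|t| ^+ n *
    (\int[P]_(w in setT) (`|X w| ^+ n * Num.min (`|t| * `|X w|) 1))%R.
Proof.
move=> mX iX partD partM part_le mpart HC.
have part0 : part 0 = 0.
  by apply: (addrI (part 0)); rewrite -partD !addr0.
have partN a : part (- a) = - part a.
  by apply: (addrI (part a)); rewrite -partD !subrr.
pose c (j : nat) : R[i] := (0 +i* t)%C ^+ j / (j`!)%:R.
(* For real x, [part] of the Taylor polynomial at i t x is a real polynomial in x, so integrating it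
   along X only involves moments. *)
pose q := \poly_(j < n.+1) part (c j).
have iXk k : (k <= n)%N -> P.-integrable setT (EFin \o (fun w => X w ^+ k)).
  exact: integrable_expr_le.
have [iq Eq] := integrable_horner iXk (size_poly _ _ : (size q <= n.+1)%N).
have zX x : (0 +i* t)%C * x%:C%C = (0 +i* (t * x))%C.
  by apply/eqP; rewrite eq_complex /= !mul0r mulr0 subr0 add0r !eqxx.
have qX x : q.[x] = part (cexp_poly n.+1 (0 +i* (t * x))%C).
  rewrite (horner_coef_wide x (size_poly _ _ : (size q <= n.+1)%N)) /cexp_poly.
  rewrite (big_morph part partD part0); apply: eq_bigr => j _.
  rewrite coef_poly ltn_ord -partM; congr part.
  by rewrite /c -zX exprMn -rmorphXn /=; rewrite mulrAC.
have -> : part (map_poly realC (\poly_(k < n.+1)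
        ((\int[P]_(w in setT) (X w ^+ k))%R / k`!%:R))).[(0 +i* t)%C] =
    (\int[P]_(w in setT) q.[X w])%R.
  have sM (p : {poly R}) : (size p <= n.+1)%N -> (size (map_poly realC p) <= n.+1)%N.
    by rewrite size_map_poly.
  rewrite Eq (horner_coef_wide _ (sM _ (size_poly _ _))).
  rewrite (big_morph part partD part0); apply: eq_bigr => j _.
  rewrite coef_map !coef_poly ltn_ord -partM; congr part.
  rewrite -[X in X * _]/(realC _) fmorph_div rmorph_nat /c.
  by rewrite mulrC mulrCA mulrC.
have E : (fun w => part (cexp ((0 +i* t)%C * (X w)%:C%C))) =
    (fun w => part (cexp (0 +i* (t * X w))%C)).
  by apply/funext => w; rewrite zX.
have i1 : P.-integrable setT (EFin \o (fun w => part (cexp (0 +i* (t * X w))%C))).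
  apply: measurable_bounded_integrable => //.
  - by rewrite [X in (X < _)%E](@probability_setT _ _ _ P) ltry.
  - exact: (measurableT_comp (mpart t)).
  - exists 1; split; first exact: num_real.
    move=> x x1 w _ /=; apply: (le_trans (part_le _)); rewrite normc_cexp /= expR0.
    exact: ltW.
have [iG _] := min_moment_cvg0 mX iX.
have iG' := iG `|t| (normr_ge0 t).
have iGC : P.-integrable setT (EFin \o (fun w =>
    C * `|t| ^+ n * (`|X w| ^+ n * Num.min (`|t| * `|X w|) 1))).
  have := integrableZl measurableT (C * `|t| ^+ n) iG'.
  by apply: eq_integrable => // w _; rewrite /= EFinM.
have i2 : P.-integrable setT
    (EFin \o (fun w => part (cexp (0 +i* (t * X w))%C) - q.[X w])).
  have := integrableB measurableT i1 iq; exact.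
rewrite E -RintegralB // -RintegralZl //.
apply: (le_trans (le_normr_Rintegral _ _)) => //.
apply: le_Rintegral => //; first exact: integrable_norm i2.
move=> w _; rewrite qX -partN -partD; apply: (le_trans (part_le _)); exact: HC.
Qed.

Lemma charfun_expansion d (T : measurableType d) (R : realType)
    (P : probability T R) (X : T -> R) n :
  measurable_fun setT X -> P.-integrable setT (EFin \o (fun w => `|X w| ^+ n)) ->
  osmall n (fun t : R => cexpectation P (fun w => cexp ((0 +i* t)%C * (X w)%:C%C))
    - (map_poly realC (\poly_(k < n.+1)
        ((\int[P]_(w in setT) (X w ^+ k))%R / k`!%:R))).[(0 +i* t)%C]).
Proof.
move=> mX iX; have [C C0 HC] := cexp_taylor_min R n.
have [_ HG] := min_moment_cvg0 mX iX.
have mlin s : measurable_fun setT (fun x : R => s * x) by apply: mulrl_measurable.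
have mcos s : measurable_fun setT (fun x : R => complex.Re (cexp (0 +i* (s * x))%C)).
  rewrite /cexp /= expR0; under eq_fun do rewrite mul1r.
  apply: (measurableT_comp _ (mlin s)); apply: continuous_measurable_fun.
  exact: continuous_cos.
have msin s : measurable_fun setT (fun x : R => complex.Im (cexp (0 +i* (s * x))%C)).
  rewrite /cexp /= expR0; under eq_fun do rewrite mul1r.
  apply: (measurableT_comp _ (mlin s)); apply: continuous_measurable_fun.
  exact: continuous_sin.
have ReM (a : R[i]) (x : R) : complex.Re (a * x%:C%C) = complex.Re a * x.
  by case: a => a b /=; rewrite mulr0 subr0.
have ImM (a : R[i]) (x : R) : complex.Im (a * x%:C%C) = complex.Im a * x.
  by case: a => a b /=; rewrite mulr0 add0r.
have ReD (a b : R[i]) : complex.Re (a + b) = complex.Re a + complex.Re b.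
  by case: a; case: b.
have ImD (a b : R[i]) : complex.Im (a + b) = complex.Im a + complex.Im b.
  by case: a; case: b.
move=> e e0; near=> t; apply: (le_trans (normc_le_ReIm _)).
have B1 := part_expectation_bound t mX iX ReD ReM (@normr_Re_le R) mcos HC.
have B2 := part_expectation_bound t mX iX ImD ImM (@normr_Im_le R) msin HC.
rewrite /cexpectation !fine_expectation.
set p := (map_poly _ _).[_] in B1 B2 *.
case: p B1 B2 => p1 p2 /= B1 B2; apply: (le_trans (lerD B1 B2)).
(* After multiplication by C, the real and imaginary parts contribute e / 2 each. *)
have HI : (\int[P]_(w in setT) (`|X w| ^+ n * Num.min (`|t| * `|X w|) 1))%R <=
    e / (2 * C).
  by near: t; apply: HG; rewrite divr_gt0 // mulr_gt0.
apply: (@le_trans _ _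
  (C * `|t| ^+ n * (e / (2 * C)) + C * `|t| ^+ n * (e / (2 * C)))).
  by rewrite lerD // ler_wpM2l // mulr_ge0 ?exprn_ge0 // ltW.
have C0' : C != 0 by rewrite gt_eqF.
by rewrite le_eqVlt; apply/orP; left; apply/eqP; move: (`|t| ^+ n) => x; field.
Unshelve. all: by end_near. Qed.

(** * Exponential generating functions of moment and cumulant vectors *)

Definition egf (R : realType) (n : nat) (x : 'rV[R]_n) : {poly R} :=
  \sum_(k < n) (x ord0 k / (k.+1)`!%:R) *: 'X^(k.+1).

(** Only the coefficients of degrees 1 to n are read, so p and 1 + p give the same vector, and p
    matters only modulo 'X^(n.+1). *)
Definition egf_inv (R : realType) (n : nat) (p : {poly R}) : 'rV[R]_n :=
  \row_(l < n) ((l.+1)`!%:R * p`_l.+1).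

Lemma logBellE (R : realType) n (x : 'rV[R]_n) :
  logBell x = egf_inv n (flog1p n (egf x)).
Proof. by []. Qed.

Lemma natr_fact_neq0 (R : numDomainType) k : k`!%:R != 0 :> R.
Proof. by rewrite pnatr_eq0 -lt0n fact_gt0. Qed.

Lemma coef_egf (R : realType) n (x : 'rV[R]_n) (l : 'I_n) :
  (egf x)`_l.+1 = x ord0 l / (l.+1)`!%:R.
Proof.
rewrite /egf coef_sum (bigD1 l) //= coefZ coefXn eqxx mulr1 big1 ?addr0 // => k kl.
by rewrite coefZ coefXn eqSS eq_sym (negbTE (_ : nat_of_ord k != l)) ?mulr0.
Qed.

Lemma coef0_egf (R : realType) n (x : 'rV[R]_n) : (egf x)`_0 = 0.
Proof.
by rewrite /egf coef_sum big1 // => k _; rewrite coefZ coefXn mulr0.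
Qed.

Lemma size_egf (R : realType) n (x : 'rV[R]_n) : (size (egf x) <= n.+1)%N.
Proof.
apply: (leq_trans (size_sum _ _ _)); apply/bigmax_leqP => k _.
by apply: (leq_trans (size_scale_leq _ _)); rewrite size_polyXn ltnS.
Qed.

Lemma egfK (R : realType) n (x : 'rV[R]_n) : egf_inv n (egf x) = x.
Proof.
apply/rowP => l; rewrite mxE coef_egf mulrC divfK //; exact: natr_fact_neq0.
Qed.

Lemma egf_invK (R : realType) n (p : {poly R}) : p`_0 = 0 ->
  eqmodX n.+1 (egf (egf_inv n p)) p.
Proof.
move=> p0 [|i]; first by rewrite coef0_egf p0.
rewrite ltnS => im; have := coef_egf (egf_inv n p) (Ordinal im) => /= ->.
by rewrite mxE /= mulrC mulKf // natr_fact_neq0.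
Qed.

Lemma egf_inv_eqmodX (R : realType) n (p q : {poly R}) :
  eqmodX n.+1 p q -> egf_inv n p = egf_inv n q.
Proof. by move=> pq; apply/rowP => l; rewrite !mxE pq // ltnS. Qed.

Lemma is_cumulantsE d (T : measurableType d) (R : realType)
    (P : probability T R) n (X : T -> R) (k : 'rV[R]_n) :
  is_cumulants P X k <->
  osmall n (fun t : R =>
    clog (cexpectation P (fun w => cexp ((0 +i* t)%C * (X w)%:C%C)))
    - (map_poly realC (egf k)).[(0 +i* t)%C]).
Proof.
have E (z : R[i]) : (map_poly realC (egf k)).[z] =
    \sum_(l < n) z ^+ l.+1 / (l.+1)`!%:R * (k ord0 l)%:C%C.
  rewrite /egf rmorph_sum horner_sum; apply: eq_bigr => l _ /=.
  rewrite map_polyZ hornerZ map_polyXn hornerXn fmorph_div rmorph_nat.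
  by rewrite mulrC mulrCA mulrC -mulrA [_^-1 * _]mulrC mulrA.
rewrite osmallP /is_cumulants.
by under eq_fun do rewrite -E.
Qed.

Lemma cumulants_unique d (T : measurableType d) (R : realType)
    (P : probability T R) n (X : T -> R) (k k' : 'rV[R]_n) :
  is_cumulants P X k -> is_cumulants P X k' -> k = k'.
Proof.
move=> /is_cumulantsE ok /is_cumulantsE ok'.
suff : map_poly realC (egf k) - map_poly realC (egf k') = 0.
  rewrite -rmorphB => /eqP; rewrite map_poly_eq0 subr_eq0 => /eqP kk'.
  by rewrite -(egfK k) kk' egfK.
apply: (@osmall_poly_eq0 _ n).
  rewrite -rmorphB size_map_poly (leq_trans (size_polyD _ _)) //.
  by rewrite geq_max size_polyN !size_egf.
apply: (osmall_le ltr01) (osmallD (osmallN ok) ok'); near=> t.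
rewrite mul1r hornerD hornerN.
set a := (map_poly _ (egf k)).[_]; set b := (map_poly _ (egf k')).[_].
set c := clog _.
by rewrite [X in _ <= Normc.normc X](_ : _ = a - b) //; ring.
Unshelve. all: by end_near. Qed.

Lemma Ln_integrable d (T : measurableType d) (R : realType)
    (P : probability T R) n (n_gt0 : (0 < n)%N) (X : Ln P n_gt0) :
  P.-integrable setT (EFin \o (fun w => `|X w| ^+ n)).
Proof.
have n1 : 1 <= n%:R :> R by rewrite ler1n.
have := Lfun_integrable n1 (LfunP X).
by under eq_fun do rewrite powR_mulrn //.
Qed.

Lemma moments_egf d (T : measurableType d) (R : realType)
    (P : probability T R) n (X : T -> R) :
  1 + egf (moments P n X) =
  \poly_(k < n.+1) ((\int[P]_(w in setT) (X w ^+ k))%R / k`!%:R).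
Proof.
apply/polyP => -[|i]; rewrite coefD coef_poly coefC /=.
  rewrite coef0_egf addr0 fact0 divr1.
  under eq_Rintegral do rewrite expr0.
  by rewrite Rintegral_cst // [X in fine X](@probability_setT _ _ _ P) mulr1.
rewrite add0r ltnS; case: ltnP => [im|mi]; last first.
  by rewrite nth_default // (leq_trans (size_egf _)).
have := coef_egf (moments P n X) (Ordinal im) => /= ->.
by rewrite mxE fine_expectation.
Qed.

Lemma cumulants_logBell d (T : measurableType d) (R : realType)
    (P : probability T R) n (n_gt0 : (0 < n)%N) (X : Ln P n_gt0) :
  cumulants P n X = logBell (moments P n X).
Proof.
have H : is_cumulants P X (logBell (moments P n X)).
  apply/is_cumulantsE.
  have := charfun_expansion (measurable_funPT X) (Ln_integrable X).
  rewrite -moments_egf => /(clog_expansion (coef0_egf _)) H.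
  (* [flog1p n] may have terms above degree n, whereas the generating function of [logBell] is cut
     off there; the difference is O(t^(n+1)). *)
  pose D := map_poly realC
    (flog1p n (egf (moments P n X)) - egf (logBell (moments P n X))).
  have D0 : eqmodX n.+1 D 0.
    move=> i im; rewrite coef_map coefB logBellE egf_invK ?subrr ?coef0 //=.
    by rewrite coef0_flog1p ?coef0_egf.
  have [K K0 HK] := horner_bound D0.
  have oD : osmall n (fun t : R => D.[(0 +i* t)%C]).
    apply: (@osmall_bigO _ _ K); near=> t; apply: HK.
    by near: t; apply: dnbhs0_le.
  apply: (osmall_le ltr01) (osmallD H oD); near=> t.
  by rewrite mul1r /D rmorphB hornerD hornerN addrA subrK.
rewrite /cumulants; case: xgetP => [k _ /= Hk|/(_ (logBell (moments P n X)))//].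
exact: cumulants_unique Hk H.
Unshelve. all: by end_near. Qed.

(** * Moments of independent sums *)

(** Independence identifies the joint law with the product of the two laws on rectangles, hence
    everywhere by uniqueness of the product measure; Fubini then factors the integral. *)
Lemma indep_integral d (T : measurableType d) (R : realType)
    (P : probability T R) (X Y : {mfun T >-> R}) (f g : R -> R) :
  indep_RV P X Y -> measurable_fun setT f -> measurable_fun setT g ->
  P.-integrable setT (EFin \o (f \o X)) -> P.-integrable setT (EFin \o (g \o Y)) ->
  P.-integrable setT (EFin \o (fun w => f (X w) * g (Y w))) /\
  (\int[P]_(w in setT) (f (X w) * g (Y w)))%R =
    (\int[P]_(w in setT) f (X w))%R * (\int[P]_(w in setT) g (Y w))%R.
Proof.
move=> XY mf mg iX iY.
pose m1 := distribution P X; pose m2 := distribution P Y.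
pose Z w := (X w, Y w).
have mZ : measurable_fun setT Z by apply: measurable_fun_pair.
pose Zm : {mfun T >-> (R * R)%type} :=
  HB.pack Z (isMeasurableFun.Build _ _ _ _ _ mZ).
pose m3 := distribution P Zm.
have E3 : forall A, measurable A -> (m1 \x m2)%E A = m3 A.
  apply: product_measure_unique => A B mA mB.
  rewrite /m3 /m1 /m2 /distribution /pushforward /= -XY //; congr (P _).
pose h (z : R * R) := (f z.1 * g z.2)%:E.
have mh : measurable_fun setT h.
  apply/measurable_EFinP; apply: measurable_funM.
    exact: (measurableT_comp mf).
  exact: (measurableT_comp mg).
have if1 : m1.-integrable setT (EFin \o f).
  by apply: integrable_pushforward => //; exact/measurable_EFinP.
have ig2 : m2.-integrable setT (EFin \o g).
  by apply: integrable_pushforward => //; exact/measurable_EFinP.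
(* The iterated integral of |h| is a product of two finite integrals. *)
have ih : (m1 \x m2)%E.-integrable setT h.
  apply/integrable12ltyP => //.
  have Ein x : (\int[m2]_y `|h (x, y)| = (`|f x|)%:E * \int[m2]_y `|(g y)%:E|)%E.
    rewrite -ge0_integralZl_EFin //; last first.
      by apply: measurableT_comp => //; exact/measurable_EFinP.
    by apply: eq_integral => y _; rewrite /h /= normrM EFinM.
  under eq_integral do rewrite Ein.
  rewrite ge0_integralZr //; last 2 first.
  - by apply/measurable_EFinP; exact: measurableT_comp.
  - exact: integral_ge0.
  have [_ H1] := integrableP _ _ _ if1; have [_ H2] := integrableP _ _ _ ig2.
  apply: lte_mul_pinfty => //; first exact: integral_ge0.
  by rewrite ge0_fin_numE // integral_ge0.
have iZ : P.-integrable setT (h \o Z).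
  apply/integrableP; split; first exact: measurableT_comp.
  have [_] := integrableP _ _ _ ih; apply: le_lt_trans.
  rewrite [leRHS](eq_measure_integral m3); last by move=> A mA _; exact: E3.
  rewrite ge0_integral_pushforward //.
  exact: measurableT_comp.
split; first exact: iZ.
have f1 := integrable_fin_num measurableT if1.
have g2 := integrable_fin_num measurableT ig2.
have Ef : (\int[P]_w (f (X w))%:E = \int[m1]_x (f x)%:E)%E.
  by rewrite integral_pushforward //; exact/measurable_EFinP.
have Eg : (\int[P]_w (g (Y w))%:E = \int[m2]_x (g x)%:E)%E.
  by rewrite integral_pushforward //; exact/measurable_EFinP.
rewrite /Rintegral Ef Eg -fineM //; congr fine.
transitivity (\int[m3]_z h z)%E; first by rewrite integral_pushforward.
rewrite -[LHS](eq_measure_integral m3 (m1 := (m1 \x m2)%E)); last first.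
  by move=> A mA _; exact: E3.
rewrite -integral12_prod_meas1 // -(fineK g2) -integralZr //.
apply: eq_integral => x _; rewrite (fineK g2) -integralZl //.
Qed.

(* [measurableTypeR R] and the canonical measurable structure on [R] have the
   same measurable sets but are distinct structures. *)
Lemma measurable_fun_toR d (T : measurableType d) (R : realType) (X : T -> R) :
  measurable_fun setT X -> measurable_fun setT (X : T -> measurableTypeR R).
Proof. by move=> mX mD B mB; exact: (mX mD B mB). Qed.

Lemma measurable_fun_fromR (R : realType) (g : R -> \bar R) :
  measurable_fun setT g -> measurable_fun setT (g : measurableTypeR R -> \bar R).
Proof. by move=> mg mD B mB; exact: (mg mD B mB). Qed.

Definition law d (T : measurableType d) (R : realType) (P : probability T R)
    (X : {mfun T >-> R}) : probability (measurableTypeR R) R :=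
  let XR : {mfun T >-> measurableTypeR R} :=
    HB.pack (X : T -> measurableTypeR R)
      (isMeasurableFun.Build _ _ T (measurableTypeR R) X
        (measurable_fun_toR (measurable_funPT X))) in
  distribution P XR.

Lemma has_law_law d (T : measurableType d) (R : realType) (P : probability T R)
    (X : {mfun T >-> R}) : has_law P X (law P X).
Proof. by []. Qed.

Lemma integral_has_law d (T : measurableType d) (R : realType)
    (P : probability T R) (X : {mfun T >-> R})
    (mu : probability (measurableTypeR R) R) (g : R -> \bar R) :
  has_law P X mu -> measurable_fun setT g -> P.-integrable setT (g \o X) ->
  (\int[mu]_x g x = \int[P]_w g (X w))%E.
Proof.
move=> lawX mg ig; rewrite (eq_measure_integral (law P X)); last first.
  by move=> A mA _; exact: (esym (lawX A mA)).
by rewrite integral_distribution //; exact: measurable_fun_fromR.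
Qed.

Lemma ge0_integral_has_law d (T : measurableType d) (R : realType)
    (P : probability T R) (X : {mfun T >-> R})
    (mu : probability (measurableTypeR R) R) (g : R -> \bar R) :
  has_law P X mu -> measurable_fun setT g -> (forall x, 0 <= g x)%E ->
  (\int[mu]_x g x = \int[P]_w g (X w))%E.
Proof.
move=> lawX mg g0; rewrite (eq_measure_integral (law P X)); last first.
  by move=> A mA _; exact: (esym (lawX A mA)).
by rewrite ge0_integral_distribution //; exact: measurable_fun_fromR.
Qed.

Lemma has_law_moments d (T : measurableType d) (R : realType)
    (P : probability T R) n (n_gt0 : (0 < n)%N) (X : Ln P n_gt0)
    (mu : probability (measurableTypeR R) R) :
  has_law P X mu ->
  moments P n X = \row_(i < n) fine (\int[mu]_x (x ^+ i.+1)%:E)%E.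
Proof.
move=> lawX; apply/rowP => i; rewrite !mxE fine_expectation /Rintegral; congr fine.
rewrite (integral_has_law (g := fun x => (x ^+ i.+1)%:E) lawX) //.
  by apply/measurable_EFinP; exact: exprn_measurable.
exact: (integrable_expr_le (measurable_funPT X) (Ln_integrable X)).
Qed.

Lemma finite_abs_moment_law d (T : measurableType d) (R : realType)
    (P : probability T R) n (n_gt0 : (0 < n)%N) (X : Ln P n_gt0) :
  finite_abs_moment n (law P X).
Proof.
rewrite /finite_abs_moment.
rewrite (ge0_integral_has_law (g := fun x => (`|x| ^+ n)%:E) (has_law_law P X)).
- have [_] := integrableP _ _ _ (Ln_integrable X); apply: le_lt_trans.
  apply: ge0_le_integral => //.
  + apply/measurable_EFinP; apply: measurable_funX.
    by apply: measurableT_comp => //; exact: measurable_funPT.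
  + apply: measurableT_comp => //; apply/measurable_EFinP; apply: measurable_funX.
    by apply: measurableT_comp => //; exact: measurable_funPT.
  + by move=> w _ /=; rewrite lee_fin ler_norm.
- by apply/measurable_EFinP; apply: measurable_funX; exact: normr_measurable.
- by move=> x; rewrite lee_fin exprn_ge0.
Qed.

(** The binomial formula: the coefficient 'C(l.+1, k) is absorbed by the factorials of the
    exponential generating functions. *)
Lemma momentsD d (T : measurableType d) (R : realType)
    (P : probability T R) n (n_gt0 : (0 < n)%N) (X Y : Ln P n_gt0) :
  indep_RV P X Y ->
  moments P n (X + Y)%R =
    egf_inv n ((1 + egf (moments P n X)) * (1 + egf (moments P n Y))).
Proof.
move=> XY; apply/rowP => l; rewrite !mxE fine_expectation.
have iX k : (k <= n)%N -> P.-integrable setT (EFin \o (fun w => X w ^+ k)).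
  exact: (integrable_expr_le (measurable_funPT X) (Ln_integrable X)).
have iY k : (k <= n)%N -> P.-integrable setT (EFin \o (fun w => Y w ^+ k)).
  exact: (integrable_expr_le (measurable_funPT Y) (Ln_integrable Y)).
have iXY k : (k < l.+2)%N ->
    P.-integrable setT (EFin \o (fun w => X w ^+ (l.+1 - k) * Y w ^+ k)) /\
    (\int[P]_(w in setT) (X w ^+ (l.+1 - k) * Y w ^+ k))%R =
    (\int[P]_(w in setT) X w ^+ (l.+1 - k))%R * (\int[P]_(w in setT) Y w ^+ k)%R.
  move=> kl; apply: (indep_integral (f := fun x => x ^+ (l.+1 - k))
      (g := fun x => x ^+ k) XY); try exact: exprn_measurable.
    by apply: iX; rewrite (leq_trans (leq_subr _ _)).
  by apply: iY; rewrite -ltnS (leq_trans kl) // ltnS ltn_ord.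
have [_] := Rintegral_lincomb (fun k => 'C(l.+1, k)%:R) (fun k kl => (iXY k kl).1).
have -> : (\int[P]_(w in setT) ((X + Y)%R w ^+ l.+1))%R =
    (\int[P]_(w in setT)
     (\sum_(k < l.+2) 'C(l.+1, k)%:R * (X w ^+ (l.+1 - k) * Y w ^+ k)))%R.
  apply: eq_Rintegral => w _; rewrite -[(X + Y)%R w]/(X w + Y w) exprDn.
  by apply: eq_bigr => k _; rewrite -mulr_natl.
move=> ->; rewrite !moments_egf coefMr mulr_sumr; apply: eq_bigr => k _.
have kn : (k <= n)%N by rewrite -ltnS (leq_trans (ltn_ord k)) // ltnS.
rewrite (iXY k (ltn_ord k)).2 !coef_poly !ltnS kn.
rewrite (leq_trans (leq_subr _ _) (ltn_ord l)).
have kl : (k <= l.+1)%N by rewrite -ltnS.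
rewrite -(bin_fact kl) !natrM.
move: ('C(l.+1, k)%:R) (natr_fact_neq0 R k) (natr_fact_neq0 R (l.+1 - k)).
move: (k`!%:R) ((l.+1 - k)`!%:R) => a b c a0 b0.
by field; rewrite a0 b0.
Qed.

(** Variables realizing x and y may be dependent. [rich] replaces them by independent ones with the
    same laws, and moments depend on the law alone. *)
Lemma moment_set_mul d (T : measurableType d) (R : realType)
    (P : probability T R) n (n_gt0 : (0 < n)%N)
    (F : Ln P n_gt0 -> R) (f : 'rV[R]_n -> R) (x y : 'rV[R]_n) :
  rich P n_gt0 ->
  (forall X : Ln P n_gt0, F X = f (moments P n X)) ->
  (forall X Y : Ln P n_gt0, indep_RV P X Y -> F (X + Y) = F X + F Y) ->
  moment_set P n_gt0 x -> moment_set P n_gt0 y ->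
  moment_set P n_gt0 (egf_inv n ((1 + egf x) * (1 + egf y))) /\
  f (egf_inv n ((1 + egf x) * (1 + egf y))) = f x + f y.
Proof.
move=> Prich Ff Fadd [X _ <-] [Y _ <-].
have [X' [Y' [XY lawX lawY]]] := Prich _ _ (finite_abs_moment_law X)
  (finite_abs_moment_law Y).
have EX : moments P n X' = moments P n X.
  by rewrite (has_law_moments lawX) (has_law_moments (has_law_law P X)).
have EY : moments P n Y' = moments P n Y.
  by rewrite (has_law_moments lawY) (has_law_moments (has_law_law P Y)).
rewrite -EX -EY -momentsD //; split; first by exists (X' + Y').
by rewrite -!Ff Fadd.
Qed.

(** These are the moments of a variable equal to t with probability p and to 0 otherwise. Its law is
    built as an image of the Bernoulli measure on [bool], where integrals are two-term sums, and
    [rich] transports it to T. *)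
Lemma bernoulli_moment_set d (T : measurableType d) (R : realType)
    (P : probability T R) n (n_gt0 : (0 < n)%N) (p t : R) :
  rich P n_gt0 -> 0 <= p <= 1 -> 0 <= t ->
  moment_set P n_gt0 (\row_(i < n) (p * t ^+ i.+1)).
Proof.
move=> Prich p01 t0.
pose B (b : bool) : R := if b then t else 0.
have mB : measurable_fun setT B by [].
pose Bm : {mfun bool >-> R} := HB.pack B (isMeasurableFun.Build _ _ _ _ _ mB).
have lawB := has_law_law (bernoulli_prob p) Bm; set mu := law _ _ in lawB.
have B0 b : 0 <= B b by rewrite /B; case: b.
have EB k : (\int[bernoulli_prob p]_b (B b ^+ k.+1)%:E = (p * t ^+ k.+1)%:E)%E.
  rewrite integral_bernoulli_prob //; last by move=> b; rewrite lee_fin exprn_ge0.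
  by rewrite /B expr0n /= mule0 adde0.
have iB k : (bernoulli_prob p).-integrable setT (fun b => (B b ^+ k.+1)%:E).
  apply/integrableP; split; first by [].
  under eq_integral do rewrite /= ger0_norm ?exprn_ge0 //.
  by rewrite EB ltry.
have mumom : finite_abs_moment n mu.
  rewrite /finite_abs_moment.
  rewrite (ge0_integral_has_law (g := fun x => (`|x| ^+ n)%:E) lawB).
  (* The exponent must be a successor for [EB], since 0 ^+ 0 is 1. *)
  - rewrite -(prednK n_gt0).
    under eq_integral do rewrite /= ger0_norm //.
    by rewrite EB ltry.
  - by apply/measurable_EFinP; apply: measurable_funX; exact: normr_measurable.
  - by move=> x; rewrite lee_fin exprn_ge0.
have [X [_ [_ lawX _]]] := Prich _ _ mumom mumom.
exists X => //; rewrite (has_law_moments lawX); apply/rowP => i; rewrite !mxE.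
rewrite (integral_has_law (g := fun x => (x ^+ i.+1)%:E) lawB).
- by rewrite EB.
- by apply/measurable_EFinP; exact: exprn_measurable.
- exact: iB.
Qed.

(** * Additive functions of moments *)

Definition cvg_coefs (R : realType) (m : nat) (s : nat -> {poly R}) (p : {poly R}) :=
  forall i, (i < m)%N -> (s k)`_i @[k --> \oo] --> p`_i.

Lemma cvg_sum_seq (R : realType) m (s : 'I_m -> nat -> R) (l : 'I_m -> R) :
  (forall i, s i k @[k --> \oo] --> l i) ->
  (\sum_(i < m) s i k) @[k --> \oo] --> \sum_(i < m) l i.
Proof.
elim: m s l => [|m IH] s l sl.
  rewrite big_ord0; under eq_fun do rewrite big_ord0; exact: cvg_cst.
rewrite big_ord_recr; under eq_fun do rewrite big_ord_recr /=.
apply: cvgD; last exact: sl.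
by apply: (IH (fun i => s (widen_ord (leqnSn m) i))
  (fun i => l (widen_ord (leqnSn m) i))).
Qed.

Lemma cvg_coefsM (R : realType) m (s s' : nat -> {poly R}) (p p' : {poly R}) :
  cvg_coefs m s p -> cvg_coefs m s' p' ->
  cvg_coefs m (fun k => s k * s' k) (p * p').
Proof.
move=> sp sp' i im; rewrite coefM; under eq_fun do rewrite coefM.
apply: cvg_sum_seq => j; apply: cvgM.
  by apply: sp; rewrite (leq_ltn_trans _ im) // -ltnS.
by apply: sp'; rewrite (leq_ltn_trans _ im) // leq_subr.
Qed.

Lemma cvg_egf_inv (R : realType) n (s : nat -> {poly R}) (p : {poly R})
    (f : 'rV[R]_n -> R) : continuous f -> cvg_coefs n.+1 s p ->
  f (egf_inv n (s k)) @[k --> \oo] --> f (egf_inv n p).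
Proof.
move=> fc sp; apply: (@cvg_comp _ _ _ (fun k => egf_inv n (s k)) f _
  (nbhs (egf_inv n p))); last exact: fc.
apply/cvg_ballP => e e0.
have H (j : 'I_n) : \forall k \near \oo,
    ball (egf_inv n p ord0 j) e (egf_inv n (s k) ord0 j).
  have : (egf_inv n (s k) ord0 j) @[k --> \oo] --> egf_inv n p ord0 j.
    under eq_fun do rewrite mxE; rewrite mxE.
    by apply: cvgMr; apply: sp; rewrite ltnS.
  by move/cvg_ballP => /(_ e e0).
near=> k; split=> // i j; rewrite (ord1 i); move: j.
by near: k; apply: filter_forall.
Unshelve. all: by end_near. Qed.

(** Up to j!, the binomial coefficient is a product of j factors m k - i; each of them divided by k
    + 1 tends to l. *)
Lemma egf_inv_exp_lim (R : realType) j (m : nat -> nat) (l : R) :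
  (m k)%:R / k.+1%:R @[k --> \oo] --> l ->
  ('C(m k, j)%:R / k.+1%:R ^+ j : R) @[k --> \oo] --> l ^+ j / j`!%:R.
Proof.
move=> ml; elim: j => [|j IH].
  rewrite expr0 fact0 divr1.
  under eq_fun do rewrite bin0 expr0 divr1; exact: cvg_cst.
have Hc : k.+1%:R^-1 @[k --> \oo] --> (0 : R) by exact: cvg_harmonic.
have E k : ('C(m k, j.+1)%:R / k.+1%:R ^+ j.+1 : R) =
    'C(m k, j)%:R / k.+1%:R ^+ j * (((m k)%:R / k.+1%:R - j%:R * k.+1%:R^-1) / j.+1%:R).
  have k0 : k.+1%:R != 0 :> R by rewrite pnatr_eq0.
  have j0 : j.+1%:R != 0 :> R by rewrite pnatr_eq0.
  (* Subtraction in R agrees with truncated subtraction here: when m k < j the binomial coefficient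
     is 0. *)
  have B : j.+1%:R * 'C(m k, j.+1)%:R = ((m k)%:R - j%:R) * 'C(m k, j)%:R :> R.
    rewrite -natrM mul_bin_left natrM; have [jm|mj] := leqP j (m k).
      by rewrite natrB.
    by rewrite bin_small // !mulr0.
  apply: (mulfI j0); rewrite [LHS]mulrA B exprS.
  move: ('C(m k, j)%:R : R) (m k)%:R (k.+1%:R ^+ j) (expf_neq0 j k0) => a b c c0.
  move: (k.+1%:R : R) (j.+1%:R : R) k0 j0 => x y x0 y0.
  by field; rewrite x0 c0 y0.
under eq_fun do rewrite E.
have -> : l ^+ j.+1 / j.+1`!%:R = l ^+ j / j`!%:R * ((l - j%:R * 0) / j.+1%:R).
  by rewrite mulr0 subr0 exprSr factS natrM invfM [X in _ * X = _]mulrC mulrACA.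
apply: cvgM => //; apply: cvgMl; apply: cvgB => //; exact: cvgMr.
Qed.

Lemma sum_ord_support (R : nmodType) (G : nat -> R) a b :
  (forall j, (a <= j)%N -> G j = 0) -> (forall j, (b <= j)%N -> G j = 0) ->
  \sum_(j < a) G j = \sum_(j < b) G j.
Proof.
wlog ab : a b / (a <= b)%N => [H|] Ga Gb.
  by case/orP: (leq_total a b) => ab; [|symmetry]; apply: H.
rewrite (big_ord_widen b G ab) [in RHS](bigID (fun j : 'I_b => (j < a)%N)) /=.
by rewrite [X in _ = _ + X]big1 ?addr0 // => j; rewrite -leqNgt => /Ga.
Qed.

(* The Poisson limit theorem at the level of exponential generating functions. *)
Lemma cvg_poisson (R : realType) n (v : {poly R}) (m : nat -> nat) (l : R) :
  v`_0 = 0 -> (m k)%:R / k.+1%:R @[k --> \oo] --> l ->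
  cvg_coefs n.+1 (fun k => (1 + k.+1%:R^-1 *: v) ^+ m k) (fexp n (l *: v)).
Proof.
move=> v0 ml i iltn.
(* The binomial expansion has m k + 1 terms, a number that varies with k; since v ^+ j has no
   coefficient of degree <= n for j > n, a sum of fixed length remains and limits can be taken
   termwise. *)
have E k : ((1 + k.+1%:R^-1 *: v) ^+ m k)`_i =
    \sum_(j < n.+1) 'C(m k, j)%:R / k.+1%:R ^+ j * (v ^+ j)`_i.
  rewrite exprDn coef_sum.
  transitivity (\sum_(j < (m k).+1) 'C(m k, j)%:R / k.+1%:R ^+ j * (v ^+ j)`_i).
    apply: eq_bigr => j _; rewrite expr1n mul1r exprZn coefMn coefZ exprVn.
    by rewrite -mulrnAl mulr_natl.
  apply: (sum_ord_support (G := fun j => 'C(m k, j)%:R / k.+1%:R ^+ j * (v ^+ j)`_i)).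
    by move=> j mj; rewrite bin_small // !mul0r.
  by move=> j nj; rewrite (eqmodX_exp0 v0 nj) ?coef0 ?mulr0.
under eq_fun do rewrite E.
rewrite /fexp coef_sum; under eq_bigr do rewrite coefZ exprZn coefZ mulrA [_^-1 * _]mulrC.
by apply: cvg_sum_seq => j; apply: cvgMl; apply: egf_inv_exp_lim.
Qed.

Lemma fexp0 (R : numFieldType) n : fexp n (0 : {poly R}) = 1.
Proof.
rewrite /fexp big_ord_recl expr0 fact0 invr1 scale1r big1 ?addr0 // => j _.
by rewrite expr0n scaler0.
Qed.

(** All that the rest of the argument retains of independence: [Omega] is stable under products of
    generating functions, and f turns these products into sums. *)
Definition additive_moments (R : realType) (n : nat) (Omega : set 'rV[R]_n)
    (f : 'rV[R]_n -> R) : Prop :=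
  forall x y, Omega x -> Omega y ->
    Omega (egf_inv n ((1 + egf x) * (1 + egf y))) /\
    f (egf_inv n ((1 + egf x) * (1 + egf y))) = f x + f y.

Definition normalized_egf (R : realType) (n : nat) (Omega : set 'rV[R]_n)
    (p : {poly R}) : Prop := p`_0 = 1 /\ Omega (egf_inv n p).

(** The Poisson generating functions are reached only in this closure. *)
Definition limit_egf (R : realType) (n : nat) (Omega : set 'rV[R]_n)
    (p : {poly R}) : Prop :=
  exists2 s : nat -> {poly R},
    forall k, normalized_egf Omega (s k) & cvg_coefs n.+1 s p.

Lemma egf_invK1 (R : realType) n (p : {poly R}) : p`_0 = 1 ->
  eqmodX n.+1 (1 + egf (egf_inv n p)) p.
Proof.
move=> p1.
have H : eqmodX n.+1 (egf (egf_inv n (p - 1))) (p - 1).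
  by apply: egf_invK; rewrite coefB coefC eqxx p1 subrr.
have -> : egf_inv n p = egf_inv n (p - 1).
  by apply/rowP => i; rewrite !mxE coefB coefC subr0.
rewrite -[p in X in eqmodX _ _ X](subrK 1) addrC.
by apply: eqmodXD.
Qed.

Lemma normalized_egfM (R : realType) n (Omega : set 'rV[R]_n) f (p q : {poly R}) :
  additive_moments Omega f ->
  normalized_egf Omega p -> normalized_egf Omega q ->
  normalized_egf Omega (p * q) /\
  f (egf_inv n (p * q)) = f (egf_inv n p) + f (egf_inv n q).
Proof.
move=> add [p1 Op] [q1 Oq]; have [] := add _ _ Op Oq.
rewrite (egf_inv_eqmodX
  (eqmodXM (egf_invK1 (n := n) p1) (egf_invK1 (n := n) q1))) => H1 H2.
split=> //; split=> //.
by rewrite -horner_coef0 hornerM !horner_coef0 p1 q1 mulr1.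
Qed.

Lemma seq_cvg_unique (R : realType) (u v : nat -> R) (a b : R) :
  u =1 v -> u k @[k --> \oo] --> a -> v k @[k --> \oo] --> b -> a = b.
Proof.
move=> /funext -> ua ub; rewrite -(cvg_lim _ ua) //; exact: cvg_lim ub.
Qed.

Lemma limit_egfM (R : realType) n (Omega : set 'rV[R]_n) f (p q : {poly R}) :
  continuous f -> additive_moments Omega f ->
  limit_egf Omega p -> limit_egf Omega q ->
  limit_egf Omega (p * q) /\
  f (egf_inv n (p * q)) = f (egf_inv n p) + f (egf_inv n q).
Proof.
move=> fc add [s ns sp] [s' ns' sp']; split.
  exists (fun k => s k * s' k); last exact: cvg_coefsM.
  by move=> k; have [] := normalized_egfM add (ns k) (ns' k).
have c1 := cvg_egf_inv fc (cvg_coefsM sp sp').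
have c2 := cvgD (cvg_egf_inv fc sp) (cvg_egf_inv fc sp').
have := seq_cvg_unique _ c1 (c2 _); apply => k /=.
by have [_ ->] := normalized_egfM add (ns k) (ns' k).
Qed.

Lemma limit_egf_eqmodX (R : realType) n (Omega : set 'rV[R]_n) (p q : {poly R}) :
  eqmodX n.+1 p q -> limit_egf Omega p -> limit_egf Omega q.
Proof.
by move=> pq [s ns sp]; exists s => // i im; rewrite -pq //; apply: sp.
Qed.

Lemma normalized_egfX (R : realType) n (Omega : set 'rV[R]_n) f (p : {poly R}) m :
  additive_moments Omega f -> Omega 0 -> normalized_egf Omega p ->
  normalized_egf Omega (p ^+ m) /\ f (egf_inv n (p ^+ m)) = m%:R * f (egf_inv n p).
Proof.
move=> add O0 np.
have E1 : egf_inv n (1 : {poly R}) = 0.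
  by apply/rowP => i; rewrite !mxE coefC mulr0.
have n1 : normalized_egf Omega (1 : {poly R}).
  by split; [rewrite coefC eqxx|rewrite E1].
elim: m => [|m [IH1 IH2]]; last first.
  rewrite exprS; have [H1 H2] := normalized_egfM add np IH1; split=> //.
  by rewrite H2 IH2 -[in RHS]nat1r mulrDl mul1r.
rewrite expr0 mul0r; split=> //.
(* Additivity at 1 * 1 = 1 forces f to vanish at 0. *)
have [_] := normalized_egfM add n1 n1; rewrite mulr1 => /eqP.
by rewrite -subr_eq subrr eq_sym => /eqP.
Qed.

Lemma cvg_truncn (R : realType) (l : R) : 0 <= l ->
  (Num.truncn (l * k.+1%:R))%:R / k.+1%:R @[k --> \oo] --> l.
Proof.
move=> l0.
apply: (squeeze_cvgr (f := fun k : nat => l - k.+1%:R^-1) (h := fun=> l)).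
- near=> k; have k0 : 0 < k.+1%:R :> R by rewrite ltr0Sn.
  have /andP[tl tu] := truncn_itv (mulr_ge0 l0 (ltW k0)).
  rewrite ler_pdivlMr // mulrBl mulVf ?gt_eqF // lerBlDr natr1 (ltW tu) /=.
  by rewrite ler_pdivrMr.
- rewrite -[X in _ --> X]subr0; apply: cvgB; first exact: cvg_cst.
  exact: cvg_harmonic.
- exact: cvg_cst.
Unshelve. all: by end_near. Qed.

(** The same summand [s k] is used for both intensities: floor (l (k + 1)) copies tend to exp (l v),
    and k + 1 copies tend to exp v. On powers of [s k], f is proportional to the number of copies,
    and the ratio of the two numbers tends to l. *)
Lemma limit_egf_poisson (R : realType) n (Omega : set 'rV[R]_n) f
    (v : {poly R}) (l : R) :
  continuous f -> additive_moments Omega f -> Omega 0 -> v`_0 = 0 ->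
  (forall k : nat, Omega (egf_inv n (k.+1%:R^-1 *: v))) -> 0 <= l ->
  limit_egf Omega (fexp n (l *: v)) /\
  f (egf_inv n (fexp n (l *: v))) = l * f (egf_inv n (fexp n v)).
Proof.
move=> fc add O0 v0 Ov l0.
pose s (k : nat) : {poly R} := 1 + k.+1%:R^-1 *: v.
have ns k : normalized_egf Omega (s k).
  split; first by rewrite coefD coefC eqxx coefZ v0 mulr0 addr0.
  suff -> : egf_inv n (s k) = egf_inv n (k.+1%:R^-1 *: v) by [].
  by apply/rowP => i; rewrite !mxE coefD coefC add0r.
have nsX k m := normalized_egfX m add O0 (ns k).
have c1 := cvg_poisson (n := n) v0 (cvg_truncn l0).
split.
  exists (fun k => s k ^+ Num.truncn (l * k.+1%:R)); last exact: c1.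
  by move=> k; exact: (nsX _ _).1.
have c2 : (fun k : nat => k.+1%:R / k.+1%:R : R) @ \oo --> (1 : R).
  under eq_fun do rewrite divff ?pnatr_eq0 //; exact: cvg_cst.
have {c2}c2 := cvg_poisson (n := n) v0 c2.
rewrite scale1r in c2.
have c3 := cvgM (cvg_truncn l0) (cvg_egf_inv fc c2).
have := seq_cvg_unique _ (cvg_egf_inv fc c1) (c3 _); apply => k /=.
by rewrite !(nsX k _).2 mulrA divfK // pnatr_eq0.
Qed.

Lemma coef0_sum_scale (R : realType) (I : Type) (r : seq I)
    (v : I -> {poly R}) (a : I -> R) :
  (forall i, (v i)`_0 = 0) -> (\sum_(i <- r) a i *: v i)`_0 = 0.
Proof.
by move=> v0; rewrite coef_sum big1 // => i _; rewrite coefZ v0 mulr0.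
Qed.

(** For v i = e^(t_i z) - 1 these are the compound Poisson generating functions with intensity [a i]
    for jumps of size t_i. *)
Lemma limit_egf_sum (R : realType) n (Omega : set 'rV[R]_n) f
    (I : Type) (r : seq I) (v : I -> {poly R}) (a : I -> R) :
  continuous f -> additive_moments Omega f -> Omega 0 ->
  (forall i, (v i)`_0 = 0) ->
  (forall i (k : nat), Omega (egf_inv n (k.+1%:R^-1 *: v i))) ->
  (forall i, 0 <= a i) ->
  limit_egf Omega (fexp n (\sum_(i <- r) a i *: v i)) /\
  f (egf_inv n (fexp n (\sum_(i <- r) a i *: v i))) =
    \sum_(i <- r) a i * f (egf_inv n (fexp n (v i))).
Proof.
move=> fc add O0 v0 Ov a0.
elim: r => [|i r [IH1 IH2]].
  rewrite !big_nil fexp0.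
  have E1 : egf_inv n (1 : {poly R}) = 0.
    by apply/rowP => i; rewrite !mxE coefC mulr0.
  have n1 : normalized_egf Omega (1 : {poly R}).
    by split; [rewrite coefC eqxx|rewrite E1].
  split; first by exists (fun=> 1) => // i _; exact: cvg_cst.
  by have [_] := normalized_egfX 0 add O0 n1; rewrite expr0 mul0r.
rewrite !big_cons.
have [H1 H2] := limit_egf_poisson fc add O0 (v0 i) (Ov i) (a0 i).
have [H3 H4] := limit_egfM fc add H1 IH1.
have av0 : (a i *: v i)`_0 = 0 by rewrite coefZ v0 mulr0.
have E := eqmodX_sym (fexpD (n := n) av0 (coef0_sum_scale r a v0)).
rewrite -(egf_inv_eqmodX E) H4 H2 IH2; split=> //.
exact: limit_egf_eqmodX E H3.
Qed.

(** Row i holds the cumulants of i.+1 times a Poisson variable of intensity 1. *)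
Definition power_mx (R : realType) (n : nat) : 'M[R]_n :=
  \matrix_(i < n, k < n) (i.+1)%:R ^+ k.+1.

(** The powers start at exponent 1, hence a diagonal factor next to the Vandermonde matrix: the
    nodes 1, ..., n must be nonzero as well as distinct. *)
Lemma power_mx_unit (R : realType) n : power_mx R n \in unitmx.
Proof.
pose a : 'rV[R]_n := \row_i (i.+1)%:R.
have -> : power_mx R n = diag_mx a *m (Vandermonde n a)^T.
  by apply/matrixP => i j; rewrite mul_diag_mx !mxE exprS.
rewrite unitmx_mul unitmx_tr !unitmxE !unitfE det_diag det_Vandermonde.
apply/andP; split; apply/prodf_neq0 => i _; first by rewrite mxE pnatr_eq0.
apply/prodf_neq0 => j ij; rewrite !mxE subr_eq0 eqr_nat eqSS.
by rewrite gtn_eqF.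
Qed.

Lemma egf_mulmx (R : realType) n (d : 'rV[R]_n) (A : 'M[R]_n) :
  egf (d *m A) = \sum_i d ord0 i *: egf (row i A).
Proof.
under [RHS]eq_bigr do rewrite /egf scaler_sumr.
rewrite exchange_big /egf /=; apply: eq_bigr => k _.
rewrite mxE mulr_suml scaler_suml; apply: eq_bigr => i _.
by rewrite scalerA mxE mulrA.
Qed.

Lemma additive_moments_logBell (R : realType) n (Omega : set 'rV[R]_n)
    (f : 'rV[R]_n -> R) :
  continuous f -> additive_moments Omega f ->
  (forall p t : R, 0 <= p <= 1 -> 0 <= t -> Omega (\row_(i < n) (p * t ^+ i.+1))) ->
  exists c : 'I_n -> R, forall x, Omega x ->
    f x = \sum_(l < n) c l * logBell x ord0 l.
Proof.
move=> fc add Ober.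
have O0 : Omega 0.
  rewrite (_ : 0 = \row_(i < n) (0 * 0 ^+ i.+1)).
    by apply: Ober; rewrite ?lexx ?ler01.
  by apply/rowP => i; rewrite !mxE mul0r.
pose v (i : 'I_n) := egf (row i (power_mx R n)).
pose w i := f (egf_inv n (fexp n (v i))).
have v0 i : (v i)`_0 = 0 by apply: coef0_egf.
have egf_invZ a p : egf_inv n (a *: p) = a *: egf_inv n p.
  by apply/rowP => i; rewrite !mxE coefZ mulrCA.
(* A variable equal to i.+1 with probability 1 / (k + 1) and to 0 otherwise. *)
have Ov i (k : nat) : Omega (egf_inv n (k.+1%:R^-1 *: v i)).
  rewrite egf_invZ egfK.
  rewrite (_ : _ *: _ = \row_(j < n) (k.+1%:R^-1 * i.+1%:R ^+ j.+1)).
    by apply: Ober => //; rewrite invr_ge0 ler0n /= invf_le1 ?ltr0Sn // ler1n.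
  by apply/rowP => j; rewrite !mxE.
have limsum := limit_egf_sum (index_enum 'I_n) fc add O0 v0 Ov.
pose W := invmx (power_mx R n).
(* The claim is that f x pairs the coordinates of [logBell x] in the basis of rows, that is
   [logBell x *m W], with the values [w] of f at the basic Poisson vectors. *)
exists (fun l => \sum_i W l i * w i) => x Ox.
pose d : 'rV[R]_n := logBell x *m W.
(* Positive and negative parts of the coordinates, both admissible as intensities in [limsum]. *)
pose a i := Num.max (d ord0 i) 0; pose b i := Num.max (- d ord0 i) 0.
have dab i : d ord0 i = a i - b i.
  rewrite /a /b; case/orP: (le_total (d ord0 i) 0) => d0.
    by rewrite (max_r d0) max_l ?oppr_ge0 // sub0r opprK.
  by rewrite (max_l d0) max_r ?oppr_le0 // subr0.
have [Ha1 Ha2] := limsum a (fun i => ltac:(by rewrite le_max lexx orbT)).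
have [Hb1 Hb2] := limsum b (fun i => ltac:(by rewrite le_max lexx orbT)).
have x0 := coef0_egf x.
have Edec : eqmodX n.+1 (flog1p n (egf x) + \sum_i b i *: v i) (\sum_i a i *: v i).
  have E1 : eqmodX n.+1 (flog1p n (egf x)) (egf (logBell x)).
    by apply/eqmodX_sym; rewrite logBellE; apply: egf_invK; apply: coef0_flog1p.
  apply: (@eqmodX_trans _ _ (egf (logBell x) + \sum_i b i *: v i)).
    exact: eqmodXD.
  suff -> : egf (logBell x) = \sum_i d ord0 i *: v i.
    rewrite -big_split /=; under eq_bigr do rewrite dab -scalerDl subrK.
    by [].
  have -> : logBell x = d *m power_mx R n by rewrite mulmxKV // power_mx_unit.
  exact: egf_mulmx.
have np : normalized_egf Omega (1 + egf x).
  split; first by rewrite coefD coefC eqxx x0 addr0.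
  suff -> : egf_inv n (1 + egf x) = x by [].
  by rewrite -[RHS]egfK; apply/rowP => i; rewrite !mxE coefD coefC add0r.
have lp : limit_egf Omega (1 + egf x).
  by exists (fun=> 1 + egf x) => // i _; exact: cvg_cst.
have fx : f (egf_inv n (1 + egf x)) = f x.
  by congr f; rewrite -[RHS]egfK; apply/rowP => i; rewrite !mxE coefD coefC add0r.
have [_ Hm] := limit_egfM fc add lp Hb1.
(* The exponential of [Edec]. Applying f to both sides gives f x plus the sum of the b i * w i on
   the left, and the sum of the a i * w i on the right. *)
have E : eqmodX n.+1 ((1 + egf x) * fexp n (\sum_i b i *: v i))
    (fexp n (\sum_i a i *: v i)).
  apply: (eqmodX_trans _ (fexp_eqmodX n Edec)).
  apply: (eqmodX_trans _ (eqmodX_sym (fexpD (n := n) (coef0_flog1p n x0)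
    (coef0_sum_scale _ b v0)))).
  by apply: eqmodXM => //; apply/eqmodX_sym/fexp_flog1p.
rewrite (egf_inv_eqmodX E) fx Ha2 Hb2 in Hm.
have -> : f x = \sum_i d ord0 i * w i.
  rewrite -[LHS](addrK (\sum_i b i * w i)) -Hm -sumrB; apply: eq_bigr => i _.
  by rewrite dab mulrBl.
under eq_bigr do rewrite mxE mulr_suml.
rewrite exchange_big /=; apply: eq_bigr => l _; rewrite mulr_suml.
by apply: eq_bigr => i _; rewrite -mulrA mulrC.
Qed.

Theorem theorem1p1 (R : realType) (d : measure_display) (T : measurableType d)
  (P : probability T R) (n : nat) (n_gt0 : (0 < n)%N)
  (P_rich : rich P n_gt0)
  (F : Ln P n_gt0 -> R) (f : 'rV[R]_n -> R)
  (f_cont : continuous f)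
  (F_moments : forall X : Ln P n_gt0, F X = f (moments P n X))
  (F_additive : forall X Y : Ln P n_gt0, indep_RV P X Y -> F (X + Y) = F X + F Y) :
  (exists c : 'I_n -> R, forall X : Ln P n_gt0,
     F X = \sum_(l < n) c l * cumulants P n X ord0 l) /\
  (forall c : 'I_n -> R,
     (forall X : Ln P n_gt0, F X = \sum_(l < n) c l * cumulants P n X ord0 l) <->
     (forall x : 'rV[R]_n, moment_set P n_gt0 x ->
        f x = \sum_(l < n) c l * logBell x ord0 l)).
Proof.
have E (X : Ln P n_gt0) : cumulants P n X = logBell (moments P n X).
  exact: cumulants_logBell.
split=> [|c]; last first.
  split=> H; first by move=> _ [X _ <-]; rewrite -F_moments H E.
  by move=> X; rewrite F_moments E; apply: H; exists X.
have add : additive_moments (moment_set P n_gt0) f.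
  by move=> x y; exact: moment_set_mul P_rich F_moments F_additive.
have [c Hc] := additive_moments_logBell f_cont add
  (fun p t => bernoulli_moment_set (p := p) (t := t) P_rich).
exists c => X; rewrite F_moments E; apply: Hc; by exists X.
Qed.
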